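(* Let $\boldsymbol{u}:\mathbb{R}^3\to\mathbb{R}^3$ be a smooth solution, with smooth pressure $p:\mathbb{R}^3\to\mathbb{R}$, of the stationary Navier-Stokes equations $$-\Delta \boldsymbol{u} + \boldsymbol{u}\cdot\nabla \boldsymbol{u} + \nabla p = 0,\qquad \operatorname{div}\boldsymbol{u}=0\qquad\text{in }\mathbb{R}^3,$$ satisfying $$\nabla\boldsymbol{u}\in L^2(\mathbb{R}^3)\qquad\text{and}\qquad \lim_{|x|\to\infty}\boldsymbol{u}(x)=0 .$$ Let $Q:=\frac{|\boldsymbol{u}|^2}{2}+p$, where the pressure is normalized by an additive constant so that $p(x)\to 0$, and hence $Q(x)\to 0$, as $|x|\to\infty$. Assume that $$\limsup_{|x|\to\infty}\frac{|\boldsymbol{u}(x)|^2}{|Q(x)|\,\bigl|\log|Q(x)|\bigr|}<\infty .$$ Then $\boldsymbol{u}\equiv 0$ in $\mathbb{R}^3$.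
   Context: The $j$-th component of $\boldsymbol{u}\cdot\nabla\boldsymbol{u}$ is $\sum_i u_i\partial_i u_j$. Under the assumptions $\nabla\boldsymbol{u}\in L^2(\mathbb{R}^3)$ and $\boldsymbol{u}\to 0$ at infinity, the pressure has a constant limit at infinity (a known fact), and since $p$ is determined only up to an additive constant it is normalized so that this limit is $0$. The limsup condition means: there exist constants $C,R_0>0$ such that $|\boldsymbol{u}(x)|^2\le C\,|Q(x)|\,\bigl|\log|Q(x)|\bigr|$ for all $|x|>R_0$, with the convention $0\cdot|\log 0|=0$ at points where $Q(x)=0$. *)

(* Defs.v *)
From HB Require Import structures.
From mathcomp Require Import all_boot all_order all_algebra.
From mathcomp Require Import all_classical all_reals all_analysis.

Set Implicit Arguments.
Unset Strict Implicit.
Unset Printing Implicit Defensive.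

Import Order.TTheory GRing.Theory Num.Theory.
Import numFieldNormedType.Exports.

Local Open Scope classical_set_scope.
Local Open Scope ring_scope.

(* The norm that MathComp-Analysis puts on ['rV[R]_n] is the sup norm, so the
   Euclidean one is spelled out. *)
Definition enorm (R : realType) (n : nat) (x : 'rV[R]_n) : R :=
  Num.sqrt (\sum_(i < n) x ord0 i ^+ 2).

(* The filter of neighbourhoods of infinity: [f @ at_infty --> l] is the limit
   of [f x] as the Euclidean norm of [x] tends to infinity. *)
Definition at_infty (R : realType) (n : nat) : set_system 'rV[R]_n :=
  [set A | exists M : R, forall x, M < enorm x -> A x].
Arguments at_infty {R n}.

Global Instance at_infty_filter (R : realType) (n : nat) :
  Filter (@at_infty R n).
Proof.
split.
- by exists 0.
- move=> A B [M HM] [N HN]; exists (Num.max M N) => x.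
  by rewrite gt_max => /andP[Mx Nx]; split; [exact: HM|exact: HN].
- by move=> A B AB [M HM]; exists M => x Mx; exact/AB/HM.
Qed.

Global Instance at_infty_proper_filter (R : realType) (n : nat) :
  ProperFilter (@at_infty R n.+1).
Proof.
split; last exact: at_infty_filter.
move=> [M HM]; apply: (HM (const_mx (`|M| + 1))).
rewrite /enorm; under eq_bigr do rewrite mxE.
rewrite sumr_const card_ord -mulr_natl sqrtrM// sqrtr_sqr.
rewrite [X in _ < _ * X]ger0_norm ?addr_ge0//.
apply: (@lt_le_trans _ _ (`|M| + 1)).
  by rewrite (le_lt_trans (ler_norm M))// ltrDl.
rewrite ler_peMl ?addr_ge0//.
by rewrite -[leLHS]sqrtr1 ler_sqrt ?ler1n.
Qed.

Definition partial (R : realType) (n : nat) (i : 'I_n) (f : 'rV[R]_n -> R) :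
  'rV[R]_n -> R := fun x => 'D_(delta_mx ord0 i) f x.

(* [iter_partial [:: i1; ...; ik] f] is d_i1 (... (d_ik f)). *)
Definition iter_partial (R : realType) (n : nat) (s : seq 'I_n)
  (f : 'rV[R]_n -> R) : 'rV[R]_n -> R := foldr (@partial R n) f s.

(* C^oo: the partial derivatives of all orders exist and are continuous.
   Existence is required explicitly, since ['D_v f x] is a total operator. *)
Definition smooth (R : realType) (n : nat) (f : 'rV[R]_n -> R) : Prop :=
  forall s : seq 'I_n,
    continuous (iter_partial s f) /\
    forall (i : 'I_n) (x : 'rV[R]_n),
      derivable (iter_partial s f) x (delta_mx ord0 i).

Definition component (R : realType) (n m : nat) (u : 'rV[R]_n -> 'rV[R]_m)
  (j : 'I_m) : 'rV[R]_n -> R := fun x => u x ord0 j.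

Definition smooth_field (R : realType) (n m : nat)
  (u : 'rV[R]_n -> 'rV[R]_m) : Prop := forall j : 'I_m, smooth (component u j).

Definition laplacian (R : realType) (n : nat) (f : 'rV[R]_n -> R) :
  'rV[R]_n -> R := fun x => \sum_(i < n) partial i (partial i f) x.

Definition divergence (R : realType) (n : nat) (u : 'rV[R]_n -> 'rV[R]_n) :
  'rV[R]_n -> R := fun x => \sum_(i < n) partial i (component u i) x.

Definition stationary_NS (R : realType) (n : nat)
  (u : 'rV[R]_n -> 'rV[R]_n) (p : 'rV[R]_n -> R) : Prop :=
  (forall (j : 'I_n) (x : 'rV[R]_n),
     - laplacian (component u j) x
     + \sum_(i < n) component u i x * partial i (component u j) x
     + partial j p x = 0) /\
  (forall x : 'rV[R]_n, divergence u x = 0).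

(* Lebesgue measure on R^3 is the threefold product of the one on the line; it
   lives on [(R * R) * R], and [point3] carries triples to row vectors. *)
Definition lebesgue3 (R : realType) :
  {measure set (measurableTypeR R * measurableTypeR R * measurableTypeR R)
     -> \bar R} :=
  ((@lebesgue_measure R \x @lebesgue_measure R) \x @lebesgue_measure R)%E.

Definition point3 (R : realType) (z : R * R * R) : 'rV[R]_3 :=
  \row_i [:: z.1.1; z.1.2; z.2]`_i.

Definition L2_R3 (R : realType) (f : 'rV[R]_3 -> R) : Prop :=
  (fun z => f (point3 z)) \in Lfun (lebesgue3 R) 2%:E.

Definition gradient_in_L2 (R : realType) (u : 'rV[R]_3 -> 'rV[R]_3) : Prop :=
  forall i j : 'I_3, L2_R3 (partial i (component u j)).

Definition total_head (R : realType) (n : nat) (u : 'rV[R]_n -> 'rV[R]_n)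
  (p : 'rV[R]_n -> R) : 'rV[R]_n -> R := fun x => enorm (u x) ^+ 2 / 2 + p x.

(* limsup of |u|^2 / (|Q| |log |Q||) at infinity is finite, in multiplied-out
   form: where Q vanishes the right-hand side is 0, so u must vanish there. *)
Definition limsup_ratio_finite (R : realType) (n : nat)
  (u : 'rV[R]_n -> 'rV[R]_n) (Q : 'rV[R]_n -> R) : Prop :=
  exists C R0 : R, [/\ 0 < C, 0 < R0 &
    forall x : 'rV[R]_n, R0 < enorm x ->
      enorm (u x) ^+ 2 <= C * (`|Q x| * `|ln `|Q x| |)].

(* Main.v *)
(* With [w = |curl u|^2], the total head [Q] satisfies [Delta Q - u . grad Q = w],
   so by the maximum principle [Q < 0] everywhere unless [w] vanishes.  Put
   [q = - Q].  As [grad q = curl u x u + curl curl u] and [curl curl u] is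
   orthogonal in L^2 to gradients, testing the equation against [g(q)], with [g]
   increasing and zero near 0, gives
     \int g'(q) |grad q|^2 = \int g(q) w  and
     \int g'(q) |grad q|^2 <= \int g'(q) |curl u x u|^2,
   whence [\int g(q) w <= \int g'(q) |u|^2 w].  The hypothesis
   [|u|^2 <= C q |log q|] and [g(s) = max(0, T - log log (1 + 1/s))^2] make the
   right-hand side [O(T)] as [T --> +oo], while the left-hand side grows like
   [T^2 w] unless [w = 0].  Then each component of [u] is harmonic and tends to 0
   at infinity. *)
Require Import Defs.
From HB Require Import structures.
From mathcomp Require Import all_boot all_order all_algebra.
From mathcomp Require Import all_classical all_reals all_analysis.
From mathcomp Require Import measurable_realfun ring lra.

Import Order.TTheory GRing.Theory Num.Theory.
Import numFieldNormedType.Exports.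

Local Open Scope classical_set_scope.
Local Open Scope ring_scope.

Set Implicit Arguments.
Unset Strict Implicit.
Unset Printing Implicit Defensive.

(** * Calculus of continuously differentiable functions *)

(** The weight [g(q)] depends on [x] only through [q]. Since [q] is positive and tends to 0, [g(q)]
    vanishes outside a ball, and every integration by parts is exact. A cut-off in [x] would instead
    leave terms over large shells that the L^2 bound on [grad u] does not obviously control. The
    drift disappears in the same way: [g(q) u . grad q] is the divergence of [H(q) u], where
    [H' = g]. The shape of [g] is dictated by the hypothesis. For [g'(q) |u|^2] to be controlled,
    [g] must be built on a function whose derivative is of order [1 / (s |log s|)] near 0, that is,
    on the iterated logarithm [L(s) = - log log (1 + 1/s)]. The weight [max(0, T + L)] would already
    set a bounded right-hand side against a left-hand side of order [T w], but it has a corner. Its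
    square is C^1 and costs one factor [T] on each side. *)

Lemma continuous_sum (R : realType) (T : topologicalType) m
    (F : 'I_m -> T -> R) :
  (forall k, continuous (F k)) -> continuous (fun x => \sum_k F k x).
Proof.
move=> cF; apply: (@continuous_big R _ +%R 0 predT) => // z.
exact: add_continuous.
Qed.

(** The closure lemmas below return this property together with the partials as equalities of
    functions, which can then be rewritten under further derivatives. *)
Definition C1 (R : realType) n (f : 'rV[R]_n -> R) : Prop :=
  continuous f /\ forall i, (forall x, derivable f x (delta_mx ord0 i)) /\
                            continuous (partial i f).

Section C1_calculus.
Context (R : realType) (n : nat).
Implicit Types (f g : 'rV[R]_n -> R) (i j : 'I_n) (x : 'rV[R]_n).

Lemma smooth_C1 f : smooth f -> C1 f.
Proof.
move=> sf; split; first by have [] := sf [::].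
by move=> i; split=> [x|]; [have [_] := sf [::]; exact | have [] := sf [:: i]].
Qed.

Lemma smooth_partial f i : smooth f -> smooth (partial i f).
Proof.
by move=> sf s; have := sf (rcons s i); rewrite /iter_partial foldr_rcons.
Qed.

Lemma C1_continuous f : C1 f -> continuous f. Proof. by case. Qed.

Lemma C1_partial_continuous f i : C1 f -> continuous (partial i f).
Proof. by case=> _ /(_ i)[]. Qed.

Lemma C1_derivable f i x : C1 f -> derivable f x (delta_mx ord0 i).
Proof. by case=> _ /(_ i)[]. Qed.

Lemma C1_is_derive f df :
  continuous f -> (forall i, continuous (df i)) ->
  (forall i x, is_derive x (delta_mx ord0 i) f (df i x)) ->
  C1 f /\ forall i, partial i f = df i.
Proof.
move=> cf cdf dfE.
have E i : partial i f = df i by apply/funext => x;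
  exact: (@derive_val _ _ _ _ _ _ _ (dfE i x)).
split=> //; split=> // i; split; last by rewrite E.
by move=> x; exact: (@ex_derive _ _ _ _ _ _ _ (dfE i x)).
Qed.

Lemma C1_derivableP f i x : C1 f ->
  is_derive x (delta_mx ord0 i) f (partial i f x).
Proof. by move=> /C1_derivable /derivableP. Qed.

Lemma C1_cst (c : R) : C1 (fun _ : 'rV[R]_n => c) /\
  forall i, partial i (fun _ : 'rV[R]_n => c) = fun _ => 0.
Proof.
by apply: C1_is_derive => *; exact: cst_continuous.
Qed.

Lemma partial_cst (c : R) i : partial i (fun _ : 'rV[R]_n => c) = fun _ => 0.
Proof. by rewrite (C1_cst c).2. Qed.

Lemma C1_add f g : C1 f -> C1 g -> C1 (fun x => f x + g x) /\
  forall i, partial i (fun x => f x + g x) = fun x =>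
    partial i f x + partial i g x.
Proof.
move=> Cf Cg; apply: C1_is_derive => [x|i x|i x] /=.
- by apply: continuousD; exact: C1_continuous.
- by apply: continuousD; exact: C1_partial_continuous.
- by apply: is_deriveD; exact: C1_derivableP.
Qed.

Lemma C1_opp f : C1 f -> C1 (fun x => - f x) /\
  forall i, partial i (fun x => - f x) = fun x => - partial i f x.
Proof.
move=> Cf; apply: C1_is_derive => [x|i x|i x] /=.
- by apply: continuousN; exact: C1_continuous.
- by apply: continuousN; exact: C1_partial_continuous.
- by apply: is_deriveN; exact: C1_derivableP.
Qed.

Lemma C1_mul f g : C1 f -> C1 g -> C1 (fun x => f x * g x) /\
  forall i, partial i (fun x => f x * g x) =
    fun x => partial i f x * g x + f x * partial i g x.
Proof.
move=> Cf Cg; apply: C1_is_derive => [x|i x|i x] /=.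
- by apply: continuousM; exact: C1_continuous.
- have a : {for x, continuous (fun x => partial i f x * g x)}.
    by apply: continuousM; [exact: C1_partial_continuous|exact: C1_continuous].
  have b : {for x, continuous (fun x => f x * partial i g x)}.
    by apply: continuousM; [exact: C1_continuous|exact: C1_partial_continuous].
  exact: (continuousD a b).
- apply: (is_derive_eq (is_deriveM (C1_derivableP i x Cf)
    (C1_derivableP i x Cg))).
  by rewrite addrC mulrC.
Qed.

Lemma C1_sum m (f : 'I_m -> 'rV[R]_n -> R) : (forall k, C1 (f k)) ->
  C1 (fun x => \sum_k f k x) /\
  forall i, partial i (fun x => \sum_k f k x) = fun x =>
    \sum_k partial i (f k) x.
Proof.
move=> Cf; apply: C1_is_derive => [x|i x|i x] /=.
- by apply: continuous_sum => k; exact: C1_continuous.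
- by apply: continuous_sum => k; exact: C1_partial_continuous.
- have := is_derive_sum (fun k => C1_derivableP i x (Cf k)).
  by rewrite (_ : \sum_k f k = fun x => \sum_k f k x)//; apply/funext => y;
    rewrite fct_sumE.
Qed.

(** The two difference quotients are the same function of [h]. This transfers the one-variable
    rules, notably the chain rule, to directional derivatives. *)
Lemma is_derive_line f x (v : 'rV[R]_n) (l : R) :
  is_derive x v f l <-> is_derive (0 : R) 1 (fun t => f (t *: v + x)) l.
Proof.
have E : (fun h : R => h^-1 *: (f (h *: v + x) - f x)) =
    (fun h : R => h^-1 *: (f ((h *: 1 + 0) *: v + x) - f (0 *: v + x))).
  by apply/funext => h; rewrite addr0 scale0r add0r [h *: 1]mulr1.
split=> [[d e]|[d e]].
- split; first by move: d; rewrite /derivable E.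
  by move: e; rewrite /derive E.
- split; first by move: d; rewrite /derivable E.
  by move: e; rewrite /derive E.
Qed.

Lemma is_derive_scalar_comp (h : R -> R) f x (v : 'rV[R]_n) (dh df : R) :
  is_derive (f x) 1 h dh -> is_derive x v f df ->
  is_derive x v (h \o f) (dh * df).
Proof.
move=> hd /is_derive_line fd; apply/is_derive_line.
by apply: is_derive1_comp; rewrite scale0r add0r.
Qed.

Lemma C1_comp (h dh : R -> R) f : C1 f ->
  (forall x, is_derive (f x) 1 h (dh (f x))) ->
  (forall x, {for f x, continuous dh}) ->
  C1 (fun x => h (f x)) /\
  forall i, partial i (fun x => h (f x)) = fun x => dh (f x) * partial i f x.
Proof.
move=> Cf hd cdh; apply: C1_is_derive => [x|i x|i x] /=.
- apply: (@continuous_comp _ _ _ f h); first exact: C1_continuous.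
  by apply/differentiable_continuous/derivable1_diffP; have [] := hd x.
- apply: continuousM; last exact: C1_partial_continuous.
  by apply: (@continuous_comp _ _ _ f dh); [exact: C1_continuous|exact: cdh].
- exact/(is_derive_scalar_comp (hd x))/C1_derivableP.
Qed.

End C1_calculus.

(** * Symmetry of second derivatives *)

Lemma dist_half (R : realFieldType) (a b c e : R) :
  `|a - c| < e / 2 -> `|b - c| < e / 2 -> `|b - a| <= e.
Proof.
move=> ac bc; rewrite (le_trans (ler_distD c _ _))// [leRHS]splitr.
by rewrite lerD ?ltW// distrC.
Qed.

Section lines.
Context (R : realType) (n : nat).
Implicit Types (f g : 'rV[R]_n -> R) (i j : 'I_n) (x : 'rV[R]_n).
Local Notation e_ i := (delta_mx (ord0 : 'I_1) i : 'rV[R]_n).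

Lemma C1_line f i x (t : R) : C1 f ->
  is_derive t 1 (fun s => f (s *: e_ i + x)) (partial i f (t *: e_ i + x)).
Proof.
move=> Cf; have [d e] := is_derive_line f (t *: e_ i +
  x) (e_ i) (partial i f (t *: e_ i + x)).
have := d (C1_derivableP i _ Cf) => {d e}.
have -> : (fun s => f (s *: e_ i + x)) =
    (fun s => f (s *: e_ i + (t *: e_ i + x))) \o (fun s => s - t).
  by apply/funext => s /=; rewrite addrA -scalerDl subrK.
set G := (fun s => f (s *: e_ i + (t *: e_ i + x))) => dG.
rewrite -[X in is_derive _ _ _ X]mulr1.
apply: is_derive1_comp; first by rewrite subrr.
by rewrite -[X in is_derive _ _ _ X]subr0; apply: is_deriveB.
Qed.

Lemma continuous_is_derive (F dF : R -> R) (a b : R) :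
  (forall t : R, is_derive t 1 F (dF t)) -> {within `[a, b], continuous F}.
Proof.
move=> d; apply/continuous_subspaceT => t.
by apply/differentiable_continuous/derivable1_diffP; have [] := d t.
Qed.

Lemma C1_MVT f i x (h : R) : C1 f -> 0 < h ->
  exists2 s, 0 < s < h &
    f (h *: e_ i + x) - f x = partial i f (s *: e_ i + x) * h.
Proof.
move=> Cf h0.
have [|s + E] := @MVT R (fun s => f (s *: e_ i + x))
   (fun s => partial i f (s *: e_ i + x)) 0 h h0 (fun s _ => C1_line i x s Cf).
  exact: (continuous_is_derive (fun t => C1_line i x t Cf)).
rewrite in_itv /= => sh; exists s => //.
by move: E; rewrite scale0r add0r subr0.
Qed.

(** The mean value theorem is used along [e_ i] on the difference between [f] shifted by [h *: e_ j]
    and [f], then along [e_ j] on [partial i f]. *)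
Lemma second_difference f i j x (h : R) : C1 f -> C1 (partial i f) -> 0 < h ->
  exists s t, [/\ 0 < s < h, 0 < t < h &
  f (h *: e_ i + (h *: e_ j + x)) - f (h *: e_ j + x) - (f (h *: e_ i +
    x) - f x)
  = partial j (partial i f) (t *: e_ j + (s *: e_ i + x)) * h * h].
Proof.
move=> Cf Cfi h0.
have [|s + E] := @MVT R
   (fun s => f (s *: e_ i + (h *: e_ j + x)) - f (s *: e_ i + x))
   (fun s => partial i f (s *: e_ i + (h *: e_ j +
     x)) - partial i f (s *: e_ i + x))
   0 h h0
   (fun s _ => is_deriveB (C1_line i (h *: e_ j + x) s Cf) (C1_line i x s Cf)).
  exact: (continuous_is_derive
    (fun s => is_deriveB (C1_line i (h *: e_ j + x) s Cf) (C1_line i x s Cf))).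
rewrite in_itv /= => sh.
have [t th Et] := C1_MVT j (s *: e_ i + x) Cfi h0.
exists s, t; split => //; move: E; rewrite !scale0r !add0r subr0.
rewrite -Et [h *: e_ j + (s *: e_ i + x)]addrCA => <-; ring.
Qed.

(** The second difference is symmetric in [i] and [j], so arbitrarily close to [x] a value of one
    mixed derivative equals a value of the other; continuity concludes. *)
Lemma partialC f i j : C1 f -> C1 (partial i f) -> C1 (partial j f) ->
  partial i (partial j f) = partial j (partial i f).
Proof.
move=> Cf Cfi Cfj; apply/funext => x.
apply/eqP; rewrite -subr_eq0 -normr_le0; apply/ler_addgt0Pr => e e0;
  rewrite add0r.
have e20 : 0 < e / 2 by rewrite divr_gt0.
have /cvgrPdist_lt /(_ _ e20) /nbhs_ballP[d1 /= d10 H1] :=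
  @C1_partial_continuous _ _ _ i Cfj x.
have /cvgrPdist_lt /(_ _ e20) /nbhs_ballP[d2 /= d20 H2] :=
  @C1_partial_continuous _ _ _ j Cfi x.
(* A step [h] with [h * K = d] keeps all intermediate points within [d] of [x]; the summand 1 makes
   this strict. *)
pose K := `|e_ i| + `|e_ j| + 1.
have K0 : 0 < K by rewrite ltr_wpDl// addr_ge0.
have [d [d0 dd1 dd2]] : exists d, [/\ 0 < d, d <= d1 & d <= d2].
  by exists (Num.min d1 d2); rewrite lt_min d10 d20 !ge_min !lexx orbT.
have [h h0 hE] : exists2 h, 0 < h & h * K = d.
  by exists (d / K); rewrite ?divr_gt0// divfK ?lt0r_neq0.
have near_x k l s t : `|e_ k| + `|e_ l| + 1 = K -> 0 < s < h -> 0 < t < h ->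
    ball x d (t *: e_ l + (s *: e_ k + x)).
  move=> EK /andP[s0 sh] /andP[t0 th].
  rewrite -ball_normE /= addrA opprD addrCA subrr addr0 normrN.
  rewrite (le_lt_trans (ler_normD _ _))// !normrZ !gtr0_norm//.
  rewrite (@le_lt_trans _ _ (h * (`|e_ k| + `|e_ l|)))//.
    by rewrite mulrDr addrC lerD// ler_wpM2r// ltW.
  by rewrite -hE ltr_pM2l// -EK ltrDl.
have [s [t [sh th E]]] := second_difference j x Cf Cfi h0.
have [s' [t' [sh' th' E']]] := second_difference i x Cf Cfj h0.
have : partial j (partial i f) (t *: e_ j + (s *: e_ i + x)) =
       partial i (partial j f) (t' *: e_ i + (s' *: e_ j + x)).
  apply: (mulIf (lt0r_neq0 h0)); apply: (mulIf (lt0r_neq0 h0)).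
  apply: (etrans (esym E)); apply: (etrans _ E').
  rewrite (addrCA (h *: e_ i)); set a := f _; set b := f _; set c := f _. ring.
have {}B1 : ball x d2 (t *: e_ j + (s *: e_ i + x)).
  by apply: le_ball (near_x i j s t erefl sh th).
have {}B2 : ball x d1 (t' *: e_ i + (s' *: e_ j + x)).
  apply: le_ball (near_x j i s' t' _ sh' th') => //.
  by rewrite [X in X + 1]addrC.
move=> ab; move: (H2 _ B1) (H1 _ B2); rewrite /= -ab => h2 h1.
exact: (dist_half h2 h1).
Qed.

End lines.

(** * Maximum principle *)

Lemma coord_le_norm (R : realType) n (x : 'rV[R]_n) i : `|x ord0 i| <= `|x|.
Proof.
rewrite [leRHS]/Num.norm /= mx_normrE.
by apply/bigmax_geP; right; exists (ord0, i).
Qed.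

Lemma norm_le_enorm (R : realType) n (x : 'rV[R]_n) : `|x| <= enorm x.
Proof.
rewrite [leLHS]/Num.norm /= mx_normrE; apply/bigmax_leP; split;
  first exact: sqrtr_ge0.
move=> [i j] _ /=; rewrite ord1 -sqrtr_sqr ler_sqrt;
  last by apply: sumr_ge0 => k _; exact: sqr_ge0.
by rewrite (bigD1 j)//= lerDl sumr_ge0// => k _; exact: sqr_ge0.
Qed.

Lemma sqr_enorm (R : realType) n (x : 'rV[R]_n) :
  enorm x ^+ 2 = \sum_(i < n) x ord0 i ^+ 2.
Proof. by rewrite sqr_sqrtr// sumr_ge0// => i _; exact: sqr_ge0. Qed.

Lemma at_infty0_norm (R : realType) n (f : 'rV[R]_n -> R) (e : R) :
  f x @[x --> at_infty] --> 0 -> 0 < e ->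
  exists M, forall x, M < `|x| -> `|f x| < e.
Proof.
move=> /cvgr0Pnorm_lt f0 /f0 [M HM]; exists M => x Mx; apply: HM.
exact: lt_le_trans (norm_le_enorm x).
Qed.

(** The closed ball of radius [M] is compact and contains [x], so the maximum over it also dominates
    the values outside. *)
Lemma continuous_attains_max (R : realType) n (f : 'rV[R]_n -> R) (x :
  'rV[R]_n) (M : R) :
  continuous f -> (forall y, M < `|y| -> f y < f x) ->
  exists y, forall z, f z <= f y.
Proof.
move=> cf fM; pose A : set 'rV[R]_n := [set y | `|y| <= M].
have Ax : A x by rewrite /A /= leNgt; apply/negP => /fM; rewrite ltxx.
have [|||y yA H] := @EVT_max_rV R n f A.
- by exists x.
- apply: bounded_closed_compact.
    exists M; split; first exact: num_real.
    by move=> N MN y /= /le_trans; apply; exact: ltW.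
  have -> : A = Num.norm @^-1` [set t : R | t <= M] by [].
  apply: closed_comp; last exact: closed_le.
  by move=> y _; exact: norm_continuous.
- exact: continuous_subspaceT.
exists y => z; have [zM|zM] := leP `|z| M; first by apply: H; rewrite inE.
by rewrite (le_trans (ltW (fM z zM)))// H// inE.
Qed.

Section maximum.
Context (R : realType) (n : nat).
Implicit Types (f g : 'rV[R]_n -> R) (i j : 'I_n) (x : 'rV[R]_n).
Local Notation e_ i := (delta_mx (ord0 : 'I_1) i : 'rV[R]_n).

Lemma max_partial_eq0 f i y : C1 f -> (forall x, f x <=
  f y) -> partial i f y = 0.
Proof.
move=> Cf ymax.
have d : is_derive (0 : R) 1 (fun s => f (s *: e_ i + y)) (partial i f y).
  by have := C1_line i y 0 Cf; rewrite scale0r add0r.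
have d0 : is_derive (0 : R) 1 (fun s => f (s *: e_ i + y)) 0.
  apply: (@derive1_at_max _ _ (-1) 1); rewrite ?in_itv/=.
  - by rewrite (le_trans (lerN10 _)).
  - by move=> t _; have [] := C1_line i y t Cf.
  - by rewrite ltrN10 ltr01.
  - by move=> t _; rewrite scale0r add0r.
by rewrite -(@derive_val _ _ _ _ _ _ _ d) (@derive_val _ _ _ _ _ _ _ d0).
Qed.

(** Were the second derivative positive at [y], it would be so nearby; two uses of the mean value
    theorem, the first derivative being 0 at [y], would then give a larger value of [f] at
    [h *: e_ i + y]. *)
Lemma max_partial2_le0 f i y : C1 f -> C1 (partial i f) ->
  (forall x, f x <= f y) -> partial i (partial i f) y <= 0.
Proof.
move=> Cf Cfi ymax; rewrite leNgt; apply/negP => L0.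
have /cvgrPdist_lt /(_ _ L0) /nbhs_ballP[d /= d0 H] :=
  @C1_partial_continuous _ _ _ i Cfi y.
have K0 : 0 < `|e_ i| + 1 by rewrite ltr_wpDl.
have [h h0 hE] : exists2 h, 0 < h & h * (`|e_ i| + 1) = d.
  by exists (d / (`|e_ i| + 1)); rewrite ?divr_gt0// divfK ?lt0r_neq0.
have [s /andP[s0 sh] Es] := C1_MVT i y Cf h0.
have [t /andP[t0 ts] Et] := C1_MVT i y Cfi s0.
have : 0 < partial i (partial i f) (t *: e_ i + y).
  have /H /= : ball y d (t *: e_ i + y).
    rewrite -ball_normE /= opprD addrC subrK normrN normrZ gtr0_norm//.
    rewrite -hE ltr_pM// ?ltW// ?ltrDl// (lt_trans ts)//.
  by move=> /(le_lt_trans (ler_norm _)); rewrite ltrBlDr ltrDl.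
move=> P; have : 0 < partial i f (s *: e_ i + y).
  by move: Et; rewrite (max_partial_eq0 _ Cf ymax) subr0 => ->;
    rewrite mulr_gt0.
move=> P2; have : 0 < f (h *: e_ i + y) - f y by rewrite Es mulr_gt0.
by rewrite subr_gt0 ltNge ymax.
Qed.

End maximum.

Lemma C1_coord (R : realType) n (k : 'I_n) :
  C1 (fun x : 'rV[R]_n => x ord0 k) /\
  forall i, partial i (fun x : 'rV[R]_n => x ord0 k) = fun _ => (i == k)%:R.
Proof.
apply: C1_is_derive => [x|i x|i x].
- exact: coord_continuous.
- exact: cst_continuous.
- apply/is_derive_line => /=.
  have -> : (fun t : R => (t *: delta_mx ord0 i + x) ord0 k) =
            (fun t : R => t * (i == k)%:R + x ord0 k).
    by apply/funext => t; rewrite !mxE eqxx /= eq_sym.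
  by apply: is_derive_eq; rewrite scaler0 add0r addr0 [LHS]mulr1.
Qed.

Section barrier.
Context (R : realType) (n : nat) (a : R) (c : 'rV[R]_n).
Implicit Types (i j : 'I_n) (x : 'rV[R]_n).

Definition dist2 x : R := \sum_k (x ord0 k - c ord0 k) ^+ 2.

(** Hopf's comparison function: away from [c] and for large [a], the term in [a ^+ 2] of its
    Laplacian dominates a bounded drift. *)
Definition barrier x : R := expR (- a * dist2 x).

Lemma C1_sub_coord k : C1 (fun x => x ord0 k - c ord0 k) /\
  forall i, partial i (fun x => x ord0 k - c ord0 k) = fun _ => (i == k)%:R.
Proof.
have [Ck dk] := C1_coord R k; have [Cc dc] := @C1_cst R n (- c ord0 k).
have [C d] := C1_add Ck Cc; split=> // i.
by rewrite d dk dc; apply/funext => x; rewrite addr0.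
Qed.

Lemma C1_dist2 : C1 dist2 /\
  forall i, partial i dist2 = fun x => 2 * (x ord0 i - c ord0 i).
Proof.
have Ck k : C1 (fun x => (x ord0 k - c ord0 k) ^+ 2) by apply: (C1_mul _ _).1;
  exact: (C1_sub_coord k).1.
have [C d] := C1_sum Ck; split=> // i; rewrite d; apply/funext => x.
transitivity (\sum_k (i == k)%:R * (2 * (x ord0 k - c ord0 k))).
  apply: eq_bigr => k _; have [Cs ds] := C1_sub_coord k.
  have [_ dm] := C1_mul Cs Cs.
  by rewrite [partial _ _ _](congr1 (fun F => F x) (dm i)) ds; ring.
rewrite (bigD1 i)//= eqxx mul1r big1 ?addr0// => k ki.
by rewrite eq_sym (negbTE ki) mul0r.
Qed.

Lemma C1_barrier : C1 barrier /\
  forall i, partial i barrier = fun x => - (2 * a) *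
    ((x ord0 i - c ord0 i) * barrier x).
Proof.
have [C d] := C1_dist2; have [Cm dm] := C1_mul (@C1_cst R n (- a)).1 C.
have [Ce de] := C1_comp Cm (fun x => is_derive_expR _)
  (fun x => @continuous_expR R _).
split=> // i; rewrite de dm d; apply/funext => x.
by rewrite partial_cst /barrier; ring.
Qed.

Lemma C1_partial_barrier i : C1 (partial i barrier) /\
  partial i (partial i barrier) =
  fun x => (4 * a ^+ 2 * (x ord0 i - c ord0 i) ^+ 2 - 2 * a) * barrier x.
Proof.
have [C d] := C1_barrier; have [Cs ds] := C1_sub_coord i.
have [Cm dm] := C1_mul Cs C.
have [Cz dz] := C1_mul (@C1_cst R n (- (2 * a))).1 Cm.
rewrite d; split=> //; rewrite dz dm ds d; apply/funext => x.
by rewrite partial_cst eqxx /=; ring.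
Qed.

Lemma laplacian_barrier x :
  laplacian barrier x = (4 * a ^+ 2 * dist2 x - 2 * n%:R * a) * barrier x.
Proof.
rewrite /laplacian; under eq_bigr do rewrite (C1_partial_barrier _).2.
rewrite -mulr_suml sumrB sumr_const card_ord -mulr_sumr; congr (_ * _).
by rewrite -mulr_natl /dist2; ring.
Qed.

End barrier.

Lemma expR_small (R : realType) (e : R) : 0 < e ->
  exists L, forall t, L < t -> expR (- t) < e.
Proof.
move=> e0; exists (- ln e) => t; rewrite ltrNl => tL.
by rewrite -[ltRHS](@lnK R) ?posrE// ltr_expR.
Qed.

Lemma norm_le_dist2 (R : realType) n (x c : 'rV[R]_n) :
  `|x - c| ^+ 2 <= dist2 c x.
Proof.
apply: (@le_trans _ _ (enorm (x - c) ^+ 2)).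
  by rewrite lerXn2r ?nnegrE ?norm_le_enorm ?sqrtr_ge0.
by rewrite sqr_enorm le_eqVlt /dist2; under eq_bigr do rewrite !mxE;
  rewrite eqxx.
Qed.

Lemma barrier_at_infty (R : realType) n (a : R) (c : 'rV[R]_n) (e : R) :
  0 < a -> 0 < e -> exists M, forall x, M < `|x| -> barrier a c x < e.
Proof.
move=> a0 e0; have [L HL] := expR_small e0.
(* The summand 1 forces [|x - c|] above 1, so that its square is at least itself and hence exceeds
   [|L| / a]. *)
exists (`|c| + (1 + `|L| / a)) => x xM; rewrite /barrier mulNr; apply: HL.
rewrite mulrC -ltr_pdivrMr//.
have xc : 1 + `|L| / a < `|x - c|.
  by rewrite -(ltrD2l `|c|) (lt_le_trans xM)// -[X in `|X| <=
    _](subrK c) addrC ler_normD.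
apply: (lt_le_trans _ (norm_le_dist2 x c)).
apply: (@le_lt_trans _ _ (1 + `|L| / a)).
  by rewrite (@le_trans _ _ (`|L| / a)) ?lerDr// ler_pM2r ?invr_gt0// ler_norm.
rewrite (lt_le_trans xc)// expr2 ler_peMl// (le_trans _ (ltW xc))// lerDl.
by rewrite divr_ge0// ltW.
Qed.

(* [f + d * barrier] has a strictly positive image under the operator away from
   [c], where [f] is already smaller, so it cannot exceed [M]. *)
Lemma strict_max_principle (R : realType) n (f : 'rV[R]_n -> R)
    (b : 'I_n -> 'rV[R]_n -> R) (B M : R) (c : 'rV[R]_n) :
  C1 f -> (forall i, C1 (partial i f)) ->
  (forall x, \sum_i b i x ^+ 2 <= B) ->
  (forall x, 0 <= laplacian f x - \sum_i b i x * partial i f x) ->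
  f x @[x --> at_infty] --> 0 ->
  0 <= M -> f c < M -> forall x, f x < M.
Proof.
move=> Cf Cdf bB Lf f0 M0 fc x1; rewrite ltNge; apply/negP => fx1.
pose d := (M - f c) / 2.
have d0 : 0 < d by rewrite divr_gt0// subr_gt0.
have [r r0 Hr] : exists2 r, 0 < r & forall x, dist2 c x < r ^+ 2 -> f x < M - d.
  have /cvgrPdist_lt /(_ _ d0) /nbhs_ballP[r /= r0 H] := @C1_continuous _ _ _
    Cf c.
  exists r => // x xr; have /H /= : ball c r x.
    rewrite -ball_normE /= distrC -ltr_sqr ?nnegrE ?(ltW r0)//.
    exact: le_lt_trans (norm_le_dist2 x c) xr.
  by rewrite ltr_norml => /andP[+ _]; rewrite /d; lra.
have B0 : 0 <= B by apply: le_trans (bB c); apply: sumr_ge0 => i _;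
  exact: sqr_ge0.
(* With [S] the sum of the [b i y * (y_i - c_i)], completing a square gives
   [2 S >= - B - dist2 c y]. This [a] then makes [4 a dist2 - 2 n + 2 S >= 1] as soon as
   [dist2 c y >= r ^+ 2], so the operator is positive on [W] there. *)
pose a := (1 + (2 * n%:R + B + 1) / r ^+ 2) / 4.
have nB0 : 0 < 2 * n%:R + B + 1 by rewrite ltr_wpDl// addr_ge0// mulr_ge0.
have q0 : 0 < (2 * n%:R + B + 1) / r ^+ 2 by rewrite divr_gt0// exprn_gt0.
have a0 : 0 < a by rewrite divr_gt0// addr_gt0.
have aE : (4 * a - 1) * r ^+ 2 = 2 * n%:R + B + 1.
  by rewrite /a [X in X * _](_ : _ = (2 * n%:R + B + 1) / r ^+ 2);
    [rewrite divfK// expf_neq0// gt_eqF|field; rewrite gt_eqF].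
have a41 : 0 < 4 * a - 1.
  by rewrite -(pmulr_lgt0 _ (exprn_gt0 2 r0)) aE.
clearbody a.
pose W := barrier a c.
have [CW dW] := C1_barrier a c.
have [CZ dZ] := C1_mul (@C1_cst R n d).1 CW.
pose G x := f x + d * W x.
have [CG dG] : C1 G /\ _ := C1_add Cf CZ.
have dGE i : partial i G = fun x => partial i f x + d * partial i W x.
  rewrite dG; apply/funext => x; rewrite dZ; congr (_ + _).
  by rewrite partial_cst; ring.
have C2 i : C1 (partial i G) /\ partial i (partial i G) =
    fun x => partial i (partial i f) x + d * partial i (partial i W) x.
  have [C' _] := C1_partial_barrier a c i.
  have [CZ' dZ'] := C1_mul (@C1_cst R n d).1 C'.
  have [CG' dG'] := C1_add (Cdf i) CZ'.
  rewrite dGE; split=> //; rewrite dG'; apply/funext => x; rewrite dZ';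
    congr (_ + _).
  by rewrite partial_cst; ring.
have W0 x : 0 < W x by exact: expR_gt0.
have Gx1 : M < G x1 by rewrite (le_lt_trans fx1)// ltrDl mulr_gt0.
have G0 : 0 < G x1 / 2 by rewrite divr_gt0// (le_lt_trans M0).
have [M1 H1] := at_infty0_norm f0 G0.
have [M2 H2] := barrier_at_infty c a0 (divr_gt0 G0 d0).
have [||y ymax] := @continuous_attains_max R n G x1 (Num.max M1 M2).
- exact: C1_continuous.
- move=> y; rewrite gt_max => /andP[/H1 h1 /H2 h2].
  rewrite [ltRHS]splitr ltrD// ?(le_lt_trans (ler_norm _) h1)//.
  by rewrite mulrC -ltr_pdivlMr.
(* Closer to [c], [f < M - d] and [W <= 1] would give [G < M], whereas [G y >= G x1 > M]. *)
have ry : r ^+ 2 <= dist2 c y.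
  rewrite leNgt; apply/negP => /Hr fy; have := lt_le_trans Gx1 (ymax x1).
  apply/negP; rewrite -leNgt /G -lerBrDr (le_trans (ltW fy))// lerB// ger_pMr//.
  rewrite -expR0 ler_expR mulNr oppr_le0 mulr_ge0 ?(ltW a0)//.
  by apply: sumr_ge0 => k _; exact: sqr_ge0.
have S1 : \sum_i (partial i (partial i f) y +
  d * partial i (partial i W) y) <= 0.
  apply: sumr_le0 => i _; have [CGi /(congr1 (fun F => F y)) <-] := C2 i.
  exact: max_partial2_le0.
have S2 : \sum_i b i y * (partial i f y + d * partial i W y) = 0.
  apply: big1 => i _; have /(congr1 (fun F => F y)) <- := dGE i.
  by rewrite (max_partial_eq0 i CG ymax) mulr0.
have S3 : 0 < laplacian W y - \sum_i b i y * partial i W y.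
  rewrite laplacian_barrier.
  under eq_bigr do rewrite dW mulrCA mulrA mulrA -[_ * (b _ _) * _]mulrA.
  rewrite -mulr_suml -mulrBl mulr_gt0// -mulr_sumr.
  set S := \sum_i _; have : 0 <= B + 2 * S + dist2 c y.
    apply: (@le_trans _ _ (\sum_i (b i y + (y ord0 i - c ord0 i)) ^+ 2)).
      by apply: sumr_ge0 => i _; exact: sqr_ge0.
    rewrite (eq_bigr (fun i => b i y ^+ 2 + 2 * (b i y *
      (y ord0 i - c ord0 i)) +
      (y ord0 i - c ord0 i) ^+ 2)); last by move=> i _; ring.
    by rewrite 2!big_split /= -mulr_sumr -/S lerD2r lerD2r.
  have : (4 * a - 1) * r ^+ 2 <= (4 * a - 1) * dist2 c y by rewrite ler_pM2l.
  rewrite aE => h1 h2.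
  rewrite (_ : _ - _ = a * (1 + (((4 * a - 1) * dist2 c y - (2 * n%:R + B +
    1)) +
    (B + 2 * S + dist2 c y)))); last ring.
  by rewrite mulr_gt0// ltr_pwDl// addr_ge0// subr_ge0.
have : 0 < (laplacian f y - \sum_i b i y * partial i f y) +
   d * (laplacian W y - \sum_i b i y * partial i W y).
  by rewrite ltr_wpDl// mulr_gt0.
rewrite mulrBr addrACA -opprD !mulr_sumr -!big_split /=.
under [X in _ - X]eq_bigr do rewrite mulrCA -mulrDr.
by rewrite S2 subr0 ltNge S1.
Qed.

(** At a positive value [f x], the strict version applies with [M = f x] and with [c] a far point,
    where decay makes [f] smaller; it yields [f x < f x]. *)
Lemma maximum_principle (R : realType) n (f : 'rV[R]_n.+1 -> R)
    (b : 'I_n.+1 -> 'rV[R]_n.+1 -> R) (B : R) :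
  C1 f -> (forall i, C1 (partial i f)) ->
  (forall x, \sum_i b i x ^+ 2 <= B) ->
  (forall x, 0 <= laplacian f x - \sum_i b i x * partial i f x) ->
  f x @[x --> at_infty] --> 0 -> forall x, f x <= 0.
Proof.
move=> Cf Cdf bB Lf f0 x; rewrite leNgt; apply/negP => fx.
have [M HM] := at_infty0_norm f0 fx.
pose c : 'rV[R]_n.+1 := const_mx (`|M| + 1).
have /HM cx : M < `|c|.
  rewrite (lt_le_trans _ (coord_le_norm c ord0))// mxE ger0_norm ?addr_ge0//.
  by rewrite (le_lt_trans (ler_norm M))// ltrDl.
have := strict_max_principle Cf Cdf bB Lf f0 (ltW fx) (le_lt_trans
  (ler_norm _) cx) x.
by rewrite ltxx.
Qed.

(** * Integration by parts on the whole space *)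

(** The preimage of any set is a countable union of fibres of [k]. *)
Lemma measurable_fun_countable_comp d d' (T : measurableType d)
    (T' : measurableType d') (I : countType) (k : T -> I) (g : I -> T') :
  (forall i, measurable (k @^-1` [set i])) -> measurable_fun setT (g \o k).
Proof.
move=> mk _ Y mY; rewrite setTI.
rewrite (_ : _ @^-1` Y = \bigcup_(i in [set i | Y (g i)]) (k @^-1` [set i])).
  rewrite bigcup_mkcond; apply: countable_bigcupT_measurable => // i.
  by case: ifP => _; [exact: mk|exact: measurable0].
by apply/seteqP; split=> [x Yx|x [i Yi /= ki]]; [exists (k x)|rewrite /= ki].
Qed.

Section point3.
Context (R : realType).
Local Notation RR := (measurableTypeR R).

Definition floor_scale (N : nat) (x : R) : int := Num.floor (N.+1%:R * x).

Lemma dist_floor_scale N x : `|x - (floor_scale N x)%:~R / N.+1%:R| <=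
  N.+1%:R^-1.
Proof.
have N0 : 0 < N.+1%:R :> R by [].
have := floor_itv (N.+1%:R * x) => /andP[h1 h2].
rewrite -(ler_pM2l N0) -[X in X * `|_|](gtr0_norm N0) -normrM mulrBr mulfV
  ?gt_eqF//.
rewrite mulrCA mulfV ?gt_eqF// mulr1 ger0_norm ?subr_ge0//.
by rewrite lerBlDl ltW// (lt_le_trans h2)// intrD.
Qed.

Lemma measurable_floor_scale N (k : int) :
  measurable (floor_scale N @^-1` [set k] : set RR).
Proof.
have N0 : 0 < N.+1%:R :> R by [].
rewrite (_ : _ @^-1` _ = `[k%:~R / N.+1%:R, (k + 1)%:~R / N.+1%:R[%classic) //.
apply/seteqP; split => x /=;
  rewrite in_itv /= ler_pdivrMr// ltr_pdivlMr// mulrC.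
  by move=> <-; rewrite floor_itv.
by move=> /floor_def.
Qed.

Lemma point3_dist (z z' : R * R * R) (e : R) : 0 < e ->
  `|z.1.1 - z'.1.1| < e -> `|z.1.2 - z'.1.2| < e -> `|z.2 - z'.2| < e ->
  `|point3 z - point3 z'| < e.
Proof.
move=> e0 h1 h2 h3; rewrite [ltLHS]/Num.norm /= mx_normrE; apply/bigmax_ltP;
  split=> //.
by case=> [i [[|[|[|//]]] lt3]] _ /=; rewrite !mxE.
Qed.

(** Rounding the coordinates to a grid of step [1 / N.+1] gives functions that factor through a
    countable set, hence measurable; by continuity they converge pointwise to [f]. This avoids
    comparing the Borel sets of row vectors with the product sigma-algebra. *)
Lemma measurable_point3_comp (f : 'rV[R]_3 -> R) : continuous f ->
  measurable_fun setT (fun z : RR * RR * RR => f (point3 z)).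
Proof.
move=> cf.
pose k N (z : RR * RR * RR) := (floor_scale N z.1.1, floor_scale N z.1.2,
  floor_scale N z.2).
pose back N (m : int * int * int) : R * R * R :=
  (m.1.1%:~R / N.+1%:R, m.1.2%:~R / N.+1%:R, m.2%:~R / N.+1%:R).
apply: (@measurable_fun_cvg _ _ _ _ (fun N => (fun m =>
  f (point3 (back N m))) \o k N)).
  move=> N; apply: measurable_fun_countable_comp => -[[a b] c].
  rewrite (_ : _ @^-1` _ = (floor_scale N @^-1` [set a] `*` floor_scale N
    @^-1` [set b])
                           `*` floor_scale N @^-1` [set c]).
    by apply: measurableX; [apply: measurableX|]; exact: measurable_floor_scale.
  apply/seteqP; split=> -[[x y] t]; rewrite /k /=; first by case.
  by case=> -[-> ->] ->.
move=> z _; apply: (@continuous_cvg _ _ _ _ _ (fun N =>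
  point3 (back N (k N z))) f).
  exact: cf.
apply/cvgrPdist_lt => e e0.
near=> N; have Ne : N.+1%:R^-1 < e.
  near: N; exact: near_infty_natSinv_lt (PosNum e0).
by apply: point3_dist => //=; apply: le_lt_trans (dist_floor_scale N _) Ne.
Unshelve. all: by end_near. Qed.

End point3.

Section integral_partial.
Context (R : realType).
Local Notation RR := (measurableTypeR R).
Local Notation leb := (@lebesgue_measure R).

Lemma integrable_bounded_support d (T : measurableType d)
    (mu : {measure set T -> \bar R}) (f : T -> R) (A : set T) (K : R) :
  measurable A -> (mu A < +oo)%E -> measurable_fun setT f ->
  (forall x, `|f x| <= K) -> (forall x, ~ A x -> f x = 0) ->
  mu.-integrable setT (EFin \o f).
Proof.
move=> mA Afin mf fK f0.
have -> : EFin \o f = (EFin \o f) \_ A.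
  apply/funext => x; rewrite patchE; case: ifPn => // /negP xA /=.
  by rewrite f0// => Ax; apply: xA; rewrite inE.
apply/(integrable_mkcond _ mA). apply: measurable_bounded_integrable => //.
  exact: measurable_funS mf.
exists K; split; first exact: num_real.
by move=> M KM x _ /=; rewrite (le_trans (fK x))// ltW.
Qed.

Definition centered_itv (M : R) : set RR := `[- M, M]%classic.

Lemma measurable_centered_itv M : measurable (centered_itv M).
Proof. exact: measurable_itv. Qed.
Hint Resolve measurable_centered_itv : core.

Lemma centered_itv_fin M : (leb (centered_itv M) < +oo)%E.
Proof. by rewrite /centered_itv lebesgue_measure_itv/=; case: ifP => _;
  rewrite ?ltry// -EFinD ltry. Qed.

Lemma notin_centered_itv M x : ~ centered_itv M x -> M < `|x|.
Proof. by move=> xM; rewrite ltNge; apply/negP; rewrite ler_norml => xM';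
  apply: xM; rewrite /centered_itv /= in_itv. Qed.

Lemma integral_derivative0 (F dF : R -> R) (M : R) : 
  (forall x : R, is_derive x 1 F (dF x)) -> continuous dF ->
  (forall x, M < `|x| -> F x = 0) -> (forall x, M < `|x| -> dF x = 0) ->
  (\int[leb]_x (dF x)%:E = 0)%E.
Proof.
(* [M] may be negative; [N] is positive and beyond [M], so [F] vanishes at both ends of
   [[- N, N]]. *)
move=> FdF cdF F0 dF0; pose N := `|M| + 1.
have N0 : 0 < N by rewrite ltr_wpDl.
have MN : M < N by rewrite (le_lt_trans (ler_norm M))// ltrDl.
rewrite (_ : (fun x => (dF x)%:E) = (EFin \o dF) \_ (centered_itv N));
  last first.
  apply/funext => x; rewrite patchE; case: ifPn => // /negP xA.
  rewrite dF0// (lt_trans MN)//; apply: notin_centered_itv => xN.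
  by apply: xA; rewrite inE.
rewrite -integral_mkcond.
rewrite (@continuous_FTC2 R dF F (- N) N).
- by rewrite !F0 ?normrN ?gtr0_norm// subee.
- by rewrite gtrN.
- exact: continuous_subspaceT.
- have cF : continuous F.
    by move=> x; apply/differentiable_continuous/derivable1_diffP;
      have [] := FdF x.
  split.
  + by move=> x _; have [] := FdF x.
  + by apply: cvg_at_right_filter; exact: cF.
  + by apply: cvg_at_left_filter; exact: cF.
- by move=> x _; rewrite derive1E; exact: (@derive_val _ _ _ _ _ _ _ (FdF x)).
Qed.

Local Notation leb2 := (leb \x leb)%E.
Local Notation leb3 := (lebesgue3 R).

Lemma norm_point3_gt (z : R * R * R) M :
  (M < `|z.1.1|) || (M < `|z.1.2|) || (M < `|z.2|) -> M < `|point3 z|.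
Proof.
move=> H; have h (i : 'I_3) := coord_le_norm (point3 z) i.
case/orP: H => [/orP[|]|] /lt_le_trans; apply.
- by have := h (@Ordinal 3 0 isT); rewrite mxE.
- by have := h (@Ordinal 3 1 isT); rewrite mxE.
- by have := h (@Ordinal 3 2 isT); rewrite mxE.
Qed.

Definition cube (M : R) : set (RR * RR * RR) :=
  (centered_itv M `*` centered_itv M) `*` centered_itv M.

Lemma measurable_cube M : measurable (cube M).
Proof. by apply: measurableX; [apply: measurableX|];
  exact: measurable_centered_itv. Qed.

Lemma square_fin M : (leb2 (centered_itv M `*` centered_itv M) < +oo)%E.
Proof.
rewrite product_measure1E// lte_mul_pinfty// ?ge0_fin_numE//;
  exact: centered_itv_fin.
Qed.

Lemma cube_fin M : (leb3 (cube M) < +oo)%E.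
Proof.
have -> : leb3 (cube M) = (leb2 (centered_itv M `*` centered_itv M) * leb
  (centered_itv M))%E.
  by apply: product_measure1E => //; exact: measurableX.
by rewrite lte_mul_pinfty// ?ge0_fin_numE//;
  [exact: square_fin|exact: centered_itv_fin].
Qed.

Lemma notin_cube M z : ~ cube M z -> M < `|point3 z|.
Proof.
move=> zM; apply: norm_point3_gt; rewrite !ltNge -!negb_and.
apply/negP => /andP[/andP[h1 h2] h3]; apply: zM.
by split; [split|]; rewrite /centered_itv/= in_itv/= -ler_norml.
Qed.

Lemma compact_support_bounded (f : 'rV[R]_3 -> R) M : continuous f ->
  (forall x, M < `|x| -> f x = 0) -> exists K, forall x, `|f x| <= K.
Proof.
move=> cf f0.
have [[x fx]|] := pselect (exists x, f x != 0); last first.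
  move=> /forallNP f00; exists 0 => x; have := f00 x.
  by move=> /negP; rewrite negbK => /eqP ->; rewrite normr0.
have [||y ymax] := @continuous_attains_max R 3 (fun x => `|f x|) x M.
- by move=> y; apply: (@continuous_comp _ _ _ f);
    [exact: cf|exact: norm_continuous].
- by move=> y /f0 ->; rewrite normr0 normr_gt0.
by exists `|f y|.
Qed.

Lemma integrable_compact_support (f : 'rV[R]_3 -> R) M : continuous f ->
  (forall x, M < `|x| -> f x = 0) ->
  leb3.-integrable setT (fun z => (f (point3 z))%:E).
Proof.
move=> cf f0; have [K fK] := compact_support_bounded cf f0.
apply: (@integrable_bounded_support _ _ leb3 (fun z =>
  f (point3 z)) (cube M) K) => //.
- exact: measurable_cube.
- exact: cube_fin.
- exact: measurable_point3_comp.
- by move=> z /notin_cube; exact: f0.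
Qed.

Lemma partial_outside_support n (f : 'rV[R]_n -> R) M i : 
  (forall x, M < `|x| -> f x = 0) -> forall x, M < `|x| -> partial i f x = 0.
Proof.
move=> f0 x xM; rewrite /partial.
rewrite (@near_eq_derive _ _ _ f (cst 0)); first exact: derive_cst.
near=> y; apply: f0; near: y.
have /cvgr_gt := @norm_continuous R _ x; exact.
Unshelve. all: by end_near. Qed.

(** As [c] has no [i]-th coordinate, that of [x t] is [t], so the line leaves the support for large
    [t]. *)
Lemma integral_line_partial (f : 'rV[R]_3 -> R) M i (x : R -> 'rV[R]_3)
    (c : 'rV[R]_3) : C1 f ->
  (forall y, M < `|y| -> f y = 0) ->
  (forall t, x t = t *: delta_mx ord0 i + c) -> c ord0 i = 0 ->
  (\int[leb]_t (partial i f (x t))%:E = 0)%E.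
Proof.
move=> Cf f0 xE ci.
have far t : M < `|t| -> M < `|x t|.
  move=> /lt_le_trans; apply; apply: le_trans (coord_le_norm (x t) i).
  by rewrite xE !mxE ci !eqxx mulr1 addr0.
apply: (@integral_derivative0 (fun t => f (x t)) (fun t =>
  partial i f (x t)) M).
- move=> t; rewrite xE (_ : (fun t => f (x t)) = fun t =>
    f (t *: delta_mx ord0 i + c)).
    exact: C1_line.
  by apply/funext => s; rewrite xE.
- have cx : continuous x.
    rewrite (_ : x = fun t => t *: delta_mx ord0 i + c); last exact/funext.
    by move=> t; apply: cvgD; [exact: scalel_continuous|exact: cvg_cst].
  by move=> t; apply: (continuous_comp (cx t)); exact: C1_partial_continuous.
- by move=> t /far; exact: f0.
- by move=> t /far; exact: partial_outside_support.
Qed.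

Lemma sigma_finite_square : sigma_finite setT leb2.
Proof.
exists (fun n => centered_itv n%:R `*` centered_itv n%:R).
  apply/esym/seteqP; split=> // -[x y] _.
  exists (Num.truncn (Num.max `|x| `|y|)).+1 => //.
  have := truncnS_gt (Num.max `|x| `|y|); rewrite gt_max => /andP[xn yn].
  by split; rewrite /centered_itv/= in_itv/= -ler_norml ltW.
by move=> n; split; [exact: measurableX|exact: square_fin].
Qed.

(* The product of two sigma-finite measures is inferred to be sigma-finite by
   the library only for subprobability measures. *)
Definition square_measure : {sigma_finite_measure set
  (RR * RR)%type -> \bar R} :=
  HB.pack_for {sigma_finite_measure set (RR * RR)%type -> \bar R} leb2
    (Measure_isSigmaFinite.Build _ _ _ leb2 sigma_finite_square).

Lemma integral_lebesgue3_21 (f : RR * RR * RR -> \bar R) :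
  leb3.-integrable setT f ->
  (\int[leb3]_z f z = \int[leb]_t \int[leb2]_z f (z, t))%E.
Proof.
move=> intf.
exact: esym (@integral21_prod_meas1 _ _ _ _ _ square_measure leb f intf).
Qed.

Lemma integral_lebesgue3_12 (f : RR * RR * RR -> \bar R) :
  leb3.-integrable setT f ->
  (\int[leb3]_z f z = \int[leb2]_z \int[leb]_t f (z, t))%E.
Proof.
move=> intf.
exact: esym (@integral12_prod_meas1 _ _ _ _ _ square_measure leb f intf).
Qed.

Lemma point3_line0 (s y t : R) : point3 (s, y, t) =
  s *: delta_mx ord0 (@Ordinal 3 0 isT) + point3 (0, y, t).
Proof.
by apply/rowP => -[[|[|[|//]]] lt3]; rewrite !mxE/= ?mulr1 ?mulr0 ?add0r ?addr0.
Qed.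

Lemma point3_line1 (s y t : R) : point3 (s, y, t) =
  y *: delta_mx ord0 (@Ordinal 3 1 isT) + point3 (s, 0, t).
Proof.
by apply/rowP => -[[|[|[|//]]] lt3]; rewrite !mxE/= ?mulr1 ?mulr0 ?add0r ?addr0.
Qed.

Lemma point3_line2 (s y t : R) : point3 (s, y, t) =
  t *: delta_mx ord0 (@Ordinal 3 2 isT) + point3 (s, y, 0).
Proof.
by apply/rowP => -[[|[|[|//]]] lt3]; rewrite !mxE/= ?mulr1 ?mulr0 ?add0r ?addr0.
Qed.

Lemma integrable_slice (f : 'rV[R]_3 -> R) M t : continuous f ->
  (forall x, M < `|x| -> f x = 0) ->
  leb2.-integrable setT (fun z => (f (point3 (z, t)))%:E).
Proof.
move=> cf f0; have [K fK] := compact_support_bounded cf f0.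
apply: (@integrable_bounded_support _ _ leb2 (fun z =>
  f (point3 (z, t))) (centered_itv M `*` centered_itv M) K) => //.
- exact: measurableX.
- exact: square_fin.
- exact: (measurable_fun_pair1 t (measurable_point3_comp cf)).
- move=> z zM; apply: f0; apply: norm_point3_gt => /=;
    rewrite !ltNge -!negb_and.
  apply/negP => /andP[/andP[h1 h2] h3]; apply: zM.
  by split; rewrite /centered_itv/= in_itv/= -ler_norml.
Qed.

(** Fubini, ordered so that the [i]-th variable is integrated innermost; the nesting of the product
    measure makes this order differ for each [i]. *)
Lemma integral_partial (f : 'rV[R]_3 -> R) M i : C1 f ->
  (forall y, M < `|y| -> f y = 0) ->
  (\int[leb3]_z (partial i f (point3 z))%:E = 0)%E.
Proof.
move=> Cf f0; have pf0 := partial_outside_support i f0.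
have cp := @C1_partial_continuous _ _ _ i Cf.
have int3 := integrable_compact_support cp pf0.
have int2 t := @integrable_slice _ M t cp pf0.
case: i int3 int2 pf0 cp => -[|[|[|//]]] lt3 int3 int2 pf0 cp.
- rewrite (integral_lebesgue3_21 int3); apply: integral0_eq => t _.
  rewrite -(integral21_prod_meas1 (int2 t)); apply: integral0_eq => y _.
  apply: (@integral_line_partial f M _ _ (point3 (0, y, t))) => //.
    by move=> s; rewrite point3_line0; congr (_ *: delta_mx _ _ + _);
      apply: val_inj.
  by rewrite mxE.
- rewrite (integral_lebesgue3_21 int3); apply: integral0_eq => t _.
  rewrite -(integral12_prod_meas1 (int2 t)); apply: integral0_eq => s _.
  apply: (@integral_line_partial f M _ _ (point3 (s, 0, t))) => //.
    by move=> y; rewrite point3_line1; congr (_ *: delta_mx _ _ + _);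
      apply: val_inj.
  by rewrite mxE.
- rewrite (integral_lebesgue3_12 int3); apply: integral0_eq => -[s y] _.
  apply: (@integral_line_partial f M _ _ (point3 (s, y, 0))) => //.
    by move=> t; rewrite point3_line2; congr (_ *: delta_mx _ _ + _);
      apply: val_inj.
  by rewrite mxE.
Qed.

End integral_partial.

(** * The iterated-logarithm cut-off *)

Section cutoff.
Context (R : realType).
Implicit Types (s t T : R).

(* Asymptotic to [- ln |ln s|] at 0, but increasing on the whole half-line. *)
Definition loglog s : R := - ln (ln (1 + s^-1)).

Definition dloglog s : R := (s * (s + 1) * ln (1 + s^-1))^-1.

Lemma ln1V_gt0 s : 0 < s -> 0 < ln (1 + s^-1).
Proof. by move=> s0; rewrite ln_gt0// ltrDl invr_gt0. Qed.

Lemma is_derive_loglog s : 0 < s -> is_derive s 1 loglog (dloglog s).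
Proof.
move=> s0; have l0 := ln1V_gt0 s0;
  have p0 : 0 < 1 + s^-1 by rewrite addr_gt0// invr_gt0.
have dV : is_derive s 1 (fun s => 1 + s^-1) (- s^-2).
  have sn0 : id s != 0 by rewrite gt_eqF.
  have d := derivableP (derivableV sn0 (@derivable_id _ _ s 1)).
  rewrite -[X in is_derive _ _ _ X]add0r.
  apply: (is_deriveD (is_derive_cst _ _ _)).
  by move: d; rewrite deriveV// derive_id /= => d; apply: is_derive_eq d _;
    rewrite [LHS]mulr1.
have dl := @is_derive1_comp _ (@ln R) (fun s =>
  1 + s^-1) s _ _ (is_derive1_ln p0) dV.
have dll := is_deriveN (@is_derive1_comp _ (@ln R) (fun s =>
  ln (1 + s^-1)) s _ _
  (is_derive1_ln l0) dl).
apply: is_derive_eq dll _; rewrite /dloglog.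
by field; rewrite !gt_eqF ?addr_gt0.
Qed.

Lemma continuous_dloglog s : 0 < s -> {for s, continuous dloglog}.
Proof.
move=> s0; have l0 := ln1V_gt0 s0;
  have p0 : 0 < 1 + s^-1 by rewrite addr_gt0// invr_gt0.
apply: cvgV; first by rewrite !mulf_neq0// gt_eqF// addr_gt0.
apply: cvgM; first by apply: cvgM; [exact: cvg_id|apply: cvgD;
  [exact: cvg_id|exact: cvg_cst]].
apply: (@continuous_comp _ _ _ (fun s => 1 + s^-1) (@ln R));
  last exact: continuous_ln.
by apply: cvgD; [exact: cvg_cst|apply: cvgV; [rewrite gt_eqF|exact: cvg_id]].
Qed.

Lemma dloglog_gt0 s : 0 < s -> 0 < dloglog s.
Proof. by move=> s0; rewrite invr_gt0 !mulr_gt0 ?addr_gt0 ?ln1V_gt0. Qed.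

(** Follows from [ln (1 + 1/s) >= ln (1/s) = |ln s|] and [s + 1 >= 1]. This matches the cut-off to
    the hypothesis on [u]: it turns [|u|^2 <= C q |log q|] into a bound on [dloglog q * |u|^2]. *)
Lemma dloglog_mul_le1 s : 0 < s -> s < 1 -> dloglog s * (s * `|ln s|) <= 1.
Proof.
move=> s0 s1; have l0 := ln1V_gt0 s0.
rewrite mulrC ler_pdivrMr ?mulr_gt0 ?addr_gt0// mul1r -mulrA ler_pM2l//.
rewrite ltr0_norm; last by rewrite ln_lt0// s0.
rewrite -lnV ?posrE//; apply: (@le_trans _ _ (ln (1 + s^-1))).
  by rewrite ler_ln ?posrE ?addr_gt0 ?invr_gt0// lerDr.
by rewrite ler_peMl ?(ltW l0)// lerDr ltW.
Qed.

Lemma ler_loglog s t : 0 < s -> s <= t -> loglog s <= loglog t.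
Proof.
move=> s0 st; have t0 := lt_le_trans s0 st.
rewrite lerN2 ler_ln ?posrE ?ln1V_gt0// ler_ln ?posrE ?addr_gt0 ?invr_gt0//.
by rewrite lerD2l lef_pV2 ?posrE.
Qed.

Lemma loglog_small T : exists2 a, 0 < a & forall s, 0 < s -> s <=
  a -> T + loglog s <= 0.
Proof.
(* For [s] below this value [1 + 1/s] exceeds [exp (exp T)], so the double logarithm is at least
   [T]. *)
exists (expR (- expR T)); first exact: expR_gt0.
move=> s s0 sa; rewrite subr_le0 -[leLHS]expRK ler_ln ?posrE ?expR_gt0
  ?ln1V_gt0//.
rewrite -[leLHS]expRK ler_ln ?posrE ?expR_gt0 ?addr_gt0 ?invr_gt0//.
rewrite (@le_trans _ _ s^-1) ?lerDr//.
by rewrite -[leLHS]invrK lef_pV2 ?posrE ?invr_gt0 ?expR_gt0// -expRN.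
Qed.

Definition pos_part s : R := Num.max 0 s.

(** Squaring removes the corner: at 0 the difference quotient is at most [|h|] in absolute value. *)
Lemma is_derive_pos_part_sqr t :
  is_derive t 1 (fun t => pos_part t ^+ 2) (2 * pos_part t).
Proof.
have [t0|t0|->] := ltrgt0P t.
- apply: (@near_eq_is_derive _ _ _ (fun t : R => t ^+ 2)).
    near=> s; rewrite /pos_part max_r// ltW//; near: s.
    exact: lt_nbhsr.
  rewrite /pos_part max_r ?(ltW t0)//.
  by apply: is_derive_eq; rewrite [_ *: _]mulr1 mulr2n mulrDl mul1r.
- apply: (@near_eq_is_derive _ _ _ (fun t : R => 0)).
    near=> s; rewrite /pos_part max_l ?expr0n// ltW//; near: s.
    exact: lt_nbhsl.
  rewrite /pos_part max_l ?(ltW t0)// mulr0; exact: is_derive_cst.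
have L : h^-1 *: (pos_part (h *: 1 + 0) ^+ 2 - pos_part 0 ^+ 2) @[h -->
  (0:R)^'] --> (0 : R).
  apply/cvgr0Pnorm_lt => e e0; near=> h.
  have hn0 : h != 0 by near: h; exact: nbhs_dnbhs_neq.
  have he : `|h| < e.
    by near: h; exact: dnbhs0_lt.
  rewrite {2}/pos_part maxxx expr0n subr0 addr0 [h *: 1]mulr1 normrM normfV.
  rewrite ltr_pdivrMl ?normr_gt0// normrX expr2.
  have le : `|pos_part h| <= `|h|.
    by rewrite /pos_part /Num.max; case: ifP => _; rewrite ?normr0.
  rewrite (@le_lt_trans _ _ (`|h| * `|h|))// ?ler_pM// ltr_pM2l ?normr_gt0//.
rewrite /pos_part maxxx mulr0; apply: DeriveDef.
  by apply/cvg_ex; exists 0; exact: L.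
exact: cvg_lim L.
Unshelve. all: by end_near. Qed.

Definition cut T s : R := pos_part (T + loglog s) ^+ 2.

Definition dcut T s : R := 2 * pos_part (T + loglog s) * dloglog s.

Lemma is_derive_cut T s : 0 < s -> is_derive s 1 (cut T) (dcut T s).
Proof.
move=> s0; apply: (@is_derive1_comp _ (fun t => pos_part t ^+ 2) (fun s =>
  T + loglog s)).
  exact: is_derive_pos_part_sqr.
rewrite -[X in is_derive _ _ _ X]add0r.
by apply: is_deriveD; exact: is_derive_loglog.
Qed.

Lemma continuous_cut T s : 0 < s -> {for s, continuous (cut T)}.
Proof.
move=> s0; apply/differentiable_continuous/derivable1_diffP.
by have [] := is_derive_cut T s0.
Qed.

Lemma continuous_dcut T s : 0 < s -> {for s, continuous (dcut T)}.
Proof.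
move=> s0; apply: cvgM; last exact: continuous_dloglog.
apply: cvgM; first exact: cvg_cst.
apply: (@continuous_comp _ _ _ (fun s => T + loglog s) pos_part).
  apply: cvgD; first exact: cvg_cst.
  apply/differentiable_continuous/derivable1_diffP.
  by have [] := is_derive_loglog s0.
by apply: continuous_max; [exact: cst_continuous|exact: cvg_id].
Qed.

Lemma dcut_ge0 T s : 0 < s -> 0 <= dcut T s.
Proof. by move=> s0; rewrite !mulr_ge0 ?le_max ?lexx// ltW// dloglog_gt0. Qed.

(** One threshold [a] serves the cut-off, its derivative and its primitive, so that the whole flux
    vanishes where [- Q <= a]. *)
Lemma cut_antiderivative T : exists a H, [/\ 0 < a,
  forall s, 0 < s -> s <= a -> [/\ cut T s = 0, dcut T s = 0 & H s = 0] &
  forall s, 0 < s -> is_derive s 1 H (cut T s)].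
Proof.
have [a a0 Ha] := loglog_small T.
have cut0 s : 0 < s -> s <= a -> cut T s = 0.
  by move=> s0 sa; rewrite /cut /pos_part max_l ?expr0n// Ha.
(* Freezing the argument below [a], where [cut T] is already 0, extends the cut-off continuously to
   the whole line, and the primitive can start at 0. *)
pose G s := cut T (Num.max s a).
have cG : continuous G.
  move=> s; apply: (@continuous_comp _ _ _ (fun s => Num.max s a) (cut T)).
    by apply: continuous_max; [exact: cvg_id|exact: cst_continuous].
  by apply: continuous_cut; rewrite lt_max a0 orbT.
pose H x : R := (\int[lebesgue_measure]_(t in `[0, x]) G t)%R.
have GE s : 0 < s -> G s = cut T s.
  move=> s0; rewrite /G; have [sa|//] := leP s a.
  by rewrite !cut0.
exists a, H; split=> // s s0.
  move=> sa; split; [exact: cut0| |].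
    by rewrite /dcut /pos_part max_l ?mulr0 ?mul0r// Ha.
  rewrite /H; under eq_Rintegral => t.
    rewrite inE /= in_itv /= => /andP[_ ts].
    have -> : G t = 0 by rewrite /G max_r ?(le_trans ts)// cut0.
    over.
  by rewrite Rintegral_cst// mul0r.
have ss1 : s < s + 1 by rewrite ltrDl.
have intG : (@lebesgue_measure R).-integrable `[0, s + 1] (EFin \o G).
  apply: continuous_compact_integrable; first exact: segment_compact.
  exact: continuous_subspaceT.
have [dH eH] := continuous_FTC1_closed ss1 intG s0 (cG s).
by apply: DeriveDef; [exact: dH|rewrite -derive1E eH GE].
Qed.

End cutoff.

(** * Vorticity and total head *)

(* Unfolding [partial] makes failing unifications diverge. *)
Local Opaque partial.

(** Lagrange's identity: the double sum of squares is twice the difference of the two sides. *)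
Lemma Cauchy_Schwarz_sum (R : realFieldType) n (a b : 'I_n -> R) :
  (\sum_i a i * b i) ^+ 2 <= (\sum_i a i ^+ 2) * (\sum_i b i ^+ 2).
Proof.
have : 0 <= \sum_i \sum_k (a i * b k - a k * b i) ^+ 2.
  by do 2! (apply: sumr_ge0 => ? _); exact: sqr_ge0.
set A := \sum_i a i ^+ 2; set B := \sum_i b i ^+ 2; set C := \sum_i _ * _.
rewrite (_ : \sum_i _ = A * B + B * A - (C * C + C * C)); first by lra.
rewrite !big_distrlr /= -!big_split -sumrB /=; apply: eq_bigr => i _.
by rewrite -!big_split -sumrB /=; apply: eq_bigr => k _; ring.
Qed.

Lemma antisymmetric_sum0 (R : realFieldType) n (D : 'I_n -> 'I_n -> R) :
  (forall i j, D i j = - D j i) -> \sum_i \sum_j D i j = 0.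
Proof.
move=> DN; have : \sum_i \sum_j D i j = - \sum_i \sum_j D i j.
  rewrite [LHS]exchange_big -sumrN; apply: eq_bigr => j _.
  by rewrite -sumrN; apply: eq_bigr => i _.
lra.
Qed.

Section vorticity.
Context (R : realType) (n : nat) (u : 'rV[R]_n -> 'rV[R]_n) (p : 'rV[R]_n -> R).
Context (u_smooth : smooth_field u) (p_smooth : smooth p) (NS :
  stationary_NS u p).
Implicit Types (i j k : 'I_n) (x : 'rV[R]_n).

(* The vorticity is the antisymmetric matrix of the differential of [u]; in
   dimension 3, [enstrophy = |curl u|^2], [lamb = curl u x u] and
   [div_vorticity = - curl curl u]. *)
Definition vorticity i j x : R :=
  partial i (component u j) x - partial j (component u i) x.

Definition enstrophy x : R := 2^-1 * \sum_i \sum_j vorticity i j x ^+ 2.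

Definition lamb j x : R := \sum_i component u i x * vorticity i j x.

Definition div_vorticity j x : R := \sum_i partial i (vorticity i j) x.

Let C1_u i : C1 (component u i). Proof. exact: smooth_C1 (u_smooth i). Qed.

Let smooth_du i j : smooth (partial i (component u j)).
Proof. exact: smooth_partial i (u_smooth j). Qed.

Lemma C1_vorticity i j : C1 (vorticity i j) /\
  forall k, partial k (vorticity i j) =
  fun x => partial k (partial i (component u j)) x - partial k (partial j
    (component u i)) x.
Proof.
have [CN dN] := C1_opp (smooth_C1 (smooth_du j i)).
have [C d] := C1_add (smooth_C1 (smooth_du i j)) CN.
by split=> // k; rewrite d dN.
Qed.

Lemma C1_partial_vorticity k i j : C1 (partial k (vorticity i j)) /\
  forall l, partial l (partial k (vorticity i j)) =
  fun x => partial l (partial k (partial i (component u j))) x -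
           partial l (partial k (partial j (component u i))) x.
Proof.
rewrite (C1_vorticity i j).2.
have [CN dN] := C1_opp (smooth_C1 (smooth_partial k (smooth_du j i))).
have [C d] := C1_add (smooth_C1 (smooth_partial k (smooth_du i j))) CN.
by split=> // l; rewrite d dN.
Qed.

Lemma vorticityN i j x : vorticity i j x = - vorticity j i x.
Proof. by rewrite /vorticity opprB. Qed.

Lemma smooth_partialC (f : 'rV[R]_n -> R) i j : smooth f ->
  partial i (partial j f) = partial j (partial i f).
Proof.
move=> sf; exact: partialC (smooth_C1 sf) (smooth_C1 (smooth_partial i sf))
  (smooth_C1 (smooth_partial j sf)).
Qed.

(** The terms [partial i (partial j u_i)] add up to [partial j] of the divergence, which is 0; in
    dimension 3 this is [Delta u = - curl curl u]. *)
Lemma laplacian_velocity j x :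
  laplacian (component u j) x = div_vorticity j x.
Proof.
have Z : \sum_i partial i (partial j (component u i)) x = 0.
  have [_ dS] := C1_sum (fun i => smooth_C1 (smooth_du i i)).
  transitivity (partial j (divergence u) x).
    rewrite [RHS](congr1 (fun F => F x) (dS j)); apply: eq_bigr => i _.
    by rewrite (smooth_partialC i j (u_smooth i)).
  have -> : divergence u = fun _ => 0 by apply/funext => y; exact: NS.2.
  by rewrite partial_cst.
transitivity (\sum_i (partial i (partial i (component u j)) x -
                       partial i (partial j (component u i)) x)).
  by rewrite sumrB [X in _ - X]Z subr0.
by apply: eq_bigr => i _; rewrite (C1_vorticity i j).2.
Qed.

Lemma C1_lamb j : C1 (lamb j) /\ forall k, partial k (lamb j) = fun x =>
  \sum_i (partial k (component u i) x * vorticity i j x +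
          component u i x * partial k (vorticity i j) x).
Proof.
have CM i := C1_mul (C1_u i) (C1_vorticity i j).1.
have [C d] := C1_sum (fun i => (CM i).1).
split=> // k; rewrite d; apply/funext => x.
by apply: eq_bigr => i _; rewrite (CM i).2.
Qed.

Lemma C1_div_vorticity j : C1 (div_vorticity j) /\
  forall k, partial k (div_vorticity j) =
  fun x => \sum_i partial k (partial i (vorticity i j)) x.
Proof. exact: (C1_sum (fun i => (C1_partial_vorticity i i j).1)). Qed.

(** Symmetric second derivatives are contracted with an antisymmetric matrix. This is the
    orthogonality of [curl curl u] to gradients, in differential form. *)
Lemma div_div_vorticity x : \sum_j partial j (div_vorticity j) x = 0.
Proof.
under eq_bigr do rewrite (C1_div_vorticity _).2.
apply: antisymmetric_sum0 => j i.
rewrite (congr1 (fun F => F x) ((C1_partial_vorticity i i j).2 j)).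
rewrite (congr1 (fun F => F x) ((C1_partial_vorticity j j i).2 i)) opprB.
exact: (f_equal2 (fun F G => F x - G x) (smooth_partialC j i (smooth_du i j))
  (smooth_partialC j i (smooth_du j i))).
Qed.

(** Lamb's form of the momentum equation: [u . grad u] equals [lamb] plus the gradient of
    [|u|^2 / 2], and the Laplacian of [u] is [div_vorticity]. *)
Lemma C1_total_head : C1 (total_head u p) /\ forall j,
  partial j (total_head u p) = fun x => div_vorticity j x - lamb j x.
Proof.
have -> : total_head u p = fun x => 2^-1 *
  (\sum_i component u i x * component u i x) + p x.
  by apply/funext => x; rewrite /total_head sqr_enorm mulrC.
have CM i := C1_mul (C1_u i) (C1_u i).
have [CS dS] := C1_sum (fun i => (CM i).1).
have [CZ dZ] := C1_mul (@C1_cst R n 2^-1).1 CS.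
have [C d] := C1_add CZ (smooth_C1 p_smooth).
split=> // j; rewrite d dZ dS; apply/funext => x;
  rewrite partial_cst mul0r add0r.
have -> : \sum_i partial j (fun x => component u i x * component u i x) x =
    2 * \sum_i component u i x * partial j (component u i) x.
  by rewrite mulr_sumr; apply: eq_bigr => i _; rewrite (CM i).2; ring.
have -> : lamb j x = \sum_i component u i x * partial i (component u j) x -
    \sum_i component u i x * partial j (component u i) x.
  by rewrite -sumrB; apply: eq_bigr => i _; rewrite mulrBr.
have := NS.1 j x; rewrite laplacian_velocity.
move: (div_vorticity j x) (partial j p x) (\sum_i _ * _) (\sum_i _ * _).
by move=> *; lra.
Qed.

Lemma C1_partial_total_head j : C1 (partial j (total_head u p)) /\ forall k,
  partial k (partial j (total_head u p)) =
  fun x => partial k (div_vorticity j) x - partial k (lamb j) x.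
Proof.
rewrite C1_total_head.2.
have [CN dN] := C1_opp (C1_lamb j).1.
have [C d] := C1_add (C1_div_vorticity j).1 CN.
by split=> // k; rewrite d dN.
Qed.

(** In the product rule, antisymmetry keeps only the antisymmetric part of [grad u] in the first
    sum, which gives [- enstrophy]. The second sum is [- u . div_vorticity], equal to [- u . grad Q]
    because [lamb] is orthogonal to [u]. *)
Lemma div_lamb x : \sum_j partial j (lamb j) x =
  - enstrophy x - \sum_j component u j x * partial j (total_head u p) x.
Proof.
have -> : \sum_j partial j (lamb j) x =
    \sum_j \sum_i partial j (component u i) x * vorticity i j x +
    \sum_j \sum_i component u i x * partial j (vorticity i j) x.
  rewrite -big_split; apply: eq_bigr => j _ /=.
  by rewrite -big_split (C1_lamb j).2.
congr (_ + _).
  have : \sum_j \sum_i partial j (component u i) x * vorticity i j x +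
         \sum_j \sum_i partial j (component u i) x * vorticity i j x =
         - \sum_i \sum_j vorticity i j x ^+ 2.
    rewrite [X in _ + X]exchange_big -big_split -sumrN; apply: eq_bigr => j _.
    rewrite -big_split -sumrN; apply: eq_bigr => i _ /=.
    by rewrite (vorticityN i j) /vorticity; ring.
  by rewrite /enstrophy; move: (\sum_i _) (\sum_i _) => a b ab; lra.
have Z : \sum_j component u j x * lamb j x = 0.
  under eq_bigr do rewrite mulr_sumr.
  by apply: antisymmetric_sum0 => j i; rewrite (vorticityN i j); ring.
have -> : \sum_j component u j x * partial j (total_head u p) x =
    \sum_j component u j x * div_vorticity j x.
  transitivity (\sum_j (component u j x * div_vorticity j x -
                        component u j x * lamb j x)).
    by apply: eq_bigr => j _; rewrite C1_total_head.2 mulrBr.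
  by rewrite sumrB [X in _ - X]Z subr0.
rewrite exchange_big -sumrN; apply: eq_bigr => i _ /=.
rewrite -mulr_sumr -mulrN -sumrN; congr (_ * _); apply: eq_bigr => j _.
by rewrite !(C1_vorticity _ _).2 opprB.
Qed.

Lemma total_head_equation x :
  laplacian (total_head u p) x -
    \sum_i component u i x * partial i (total_head u p) x = enstrophy x.
Proof.
have -> : laplacian (total_head u p) x = - \sum_j partial j (lamb j) x.
  transitivity (\sum_j (partial j (div_vorticity j) x - partial j (lamb j) x)).
    by apply: eq_bigr => j _; rewrite (C1_partial_total_head j).2.
  by rewrite sumrB [X in X - _]div_div_vorticity sub0r.
by rewrite div_lamb opprD !opprK addrK.
Qed.

(** Cauchy-Schwarz in the sum defining each [lamb u j x]; the factor 2 undoes the [2^-1] in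
    [enstrophy]. *)
Lemma sqr_lamb_le x : \sum_j lamb j x ^+ 2 <=
  2 * enorm (u x) ^+ 2 * enstrophy x.
Proof.
rewrite /enstrophy mulrA [2 * _]mulrC mulfK// sqr_enorm exchange_big mulr_sumr.
by apply: ler_sum => j _; exact: Cauchy_Schwarz_sum.
Qed.

End vorticity.

(** * Energy estimate *)

Section flux.
Context (R : realType) (n : nat) (u : 'rV[R]_n -> 'rV[R]_n) (p : 'rV[R]_n -> R).
Context (u_smooth : smooth_field u) (p_smooth : smooth p) (NS :
  stationary_NS u p).
Local Notation Q := (total_head u p).
Context (Q_lt0 : forall x, Q x < 0).
Context (T : R) (H : R -> R)
  (dH : forall s : R, 0 < s -> is_derive s 1 H (cut T s)).
Implicit Types (i j k : 'I_n) (x : 'rV[R]_n).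

(* Since [grad (- Q) = lamb - div_vorticity], this is [F (grad (- Q)) - H
  (- Q) u]
   plus [2 F div_vorticity] with [F = cut T (- Q)]; adding the latter completes
   the square in the divergence. *)
Definition flux j x : R :=
  cut T (- Q x) * (lamb u j x + div_vorticity u j x) - H
    (- Q x) * component u j x.

Lemma C1_flux j : C1 (flux j) /\ forall k, partial k (flux j) = fun x =>
  (dcut T (- Q x) * - partial k Q x) * (lamb u j x + div_vorticity u j x) +
  cut T (- Q x) * (partial k (lamb u j) x + partial k (div_vorticity u j) x) -
  ((cut T (- Q x) * - partial k Q x) * component u j x +
    H (- Q x) * partial k (component u j) x).
Proof.
have Q0 x : 0 < - Q x by rewrite oppr_gt0.
have [Cq dq] := C1_opp (C1_total_head u_smooth p_smooth NS).1.
have [CF dF] := C1_comp Cq (fun x => is_derive_cut T (Q0 x))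
  (fun x => continuous_dcut (Q0 x)).
have [CH dHE] := C1_comp Cq (fun x => dH (Q0 x)) (fun x =>
  continuous_cut (Q0 x)).
have [Cs ds] := C1_add (C1_lamb u_smooth j).1 (C1_div_vorticity u_smooth j).1.
have [C1' d1] := C1_mul CF Cs.
have [C2 d2] := C1_mul CH (smooth_C1 (u_smooth j)).
have [C2' d2'] := C1_opp C2.
have [C d] := C1_add C1' C2'.
by split=> // k; rewrite d d1 d2' d2 ds dF dHE dq.
Qed.

(** The product of [grad (- Q) = lamb - div_vorticity] with [lamb + div_vorticity] is a difference
    of squares, and the transport term from [div_lamb] cancels the one from [H (- Q) u]. Both
    integral relations of the overview are thus contained in one divergence. *)
Lemma div_flux x : \sum_j partial j (flux j) x =
  dcut T (- Q x) * (\sum_j lamb u j x ^+ 2 - \sum_j div_vorticity u j x ^+ 2) -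
  cut T (- Q x) * enstrophy u x.
Proof.
transitivity (\sum_j (dcut T (- Q x) * lamb u j x ^+ 2 -
    dcut T (- Q x) * div_vorticity u j x ^+ 2 +
    (cut T (- Q x) * partial j (lamb u j) x +
     cut T (- Q x) * partial j (div_vorticity u j) x) +
    (cut T (- Q x) * (component u j x * partial j Q x) -
     H (- Q x) * partial j (component u j) x))).
  apply: eq_bigr => j _; rewrite (C1_flux j).2.
  have -> : partial j Q x = div_vorticity u j x - lamb u j x.
    by rewrite (C1_total_head u_smooth p_smooth NS).2.
  move: (partial j (lamb u j) x) (partial j (div_vorticity u j) x)
    (partial j (component u j) x) => a b c; ring.
rewrite !big_split /= -!sumrN !sumrN -!mulr_sumr.
rewrite [X in cut _ _ * X + _](div_lamb u_smooth p_smooth NS).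
rewrite [X in _ + cut _ _ * X](div_div_vorticity u_smooth).
have -> : \sum_j partial j (component u j) x = 0 by exact: NS.2.
move: (\sum_j component u j x * _) => S; ring.
Qed.

Lemma div_flux_le x : \sum_j partial j (flux j) x <=
  dcut T (- Q x) * (2 * enorm (u x) ^+ 2 * enstrophy u x) -
  cut T (- Q x) * enstrophy u x.
Proof.
rewrite div_flux lerD2r ler_wpM2l ?dcut_ge0 ?oppr_gt0//.
rewrite (le_trans _ (sqr_lamb_le u x))// gerBl sumr_ge0// => j _.
exact: sqr_ge0.
Qed.

End flux.

Lemma quadratic_gt_linear (R : realFieldType) (v c A B T0 : R) :
  0 < v -> 0 <= c -> ~ (forall T, T0 <= T -> (T + A) ^+ 2 * v <= c * (T + B)).
Proof.
move=> v0 c0 h.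
(* [t] stands for [T + A]: it is at least 1, passes the threshold [T0 + A], and is large enough for
   [t ^+ 2 * v] to exceed [c * t * (1 + |B - A|)], a bound for the right-hand side. *)
pose t := 1 + `|T0 + A| + c / v * (1 + `|B - A|).
have cv0 : 0 <= c / v by rewrite divr_ge0// ltW.
have t1 : 1 <= t.
  by rewrite /t -addrA lerDl addr_ge0// mulr_ge0// addr_ge0.
have := h (t - A); rewrite lerBrDr subrK.
have -> : T0 + A <= t.
  rewrite (le_trans (ler_norm _))// /t addrAC lerDr addr_ge0// mulr_ge0//
    addr_ge0//.
move=> /(_ isT); rewrite leNgt => /negP; apply.
have -> : t - A + B = t + (B - A) by ring.
apply: (@le_lt_trans _ _ (c * t * (1 + `|B - A|))).
  rewrite -mulrA ler_wpM2l// mulrDr mulr1 lerD2l.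
  by rewrite (le_trans (ler_norm _))// ler_peMl.
have -> : c * t * (1 + `|B - A|) = t * (c / v * (1 + `|B - A|)) * v.
  by field; rewrite gt_eqF.
rewrite ltr_pM2r// expr2 ltr_pM2l ?(lt_le_trans ltr01)// /t ltrDr.
by rewrite ltr_pwDl.
Qed.

(** * Integrals over R^3: divergences, enstrophy, boxes *)

Section integral.
Context (R : realType).
Local Notation RR := (measurableTypeR R).
Local Notation leb := (@lebesgue_measure R).
Local Notation leb3 := (lebesgue3 R).

Lemma integral_div (f : 'I_3 -> 'rV[R]_3 -> R) M : (forall j, C1 (f j)) ->
  (forall j x, M < `|x| -> f j x = 0) ->
  leb3.-integrable setT (fun z => (\sum_j partial j (f j) (point3 z))%:E) /\
  (\int[leb3]_z (\sum_j partial j (f j) (point3 z))%:E = 0)%E.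
Proof.
move=> Cf f0.
have I j : leb3.-integrable setT (fun z => (partial j (f j) (point3 z))%:E).
  apply: (@integrable_compact_support _ _ M);
    first exact: C1_partial_continuous (Cf j).
  exact: partial_outside_support (f0 j).
have E : (fun z => (\sum_j partial j (f j) (point3 z))%:E) =
         (fun z => \sum_j (partial j (f j) (point3 z))%:E)%E.
  by apply/funext => z; rewrite sumEFin.
rewrite E; split; first exact: integrable_sum.
rewrite integral_sum// big1// => j _.
exact: integral_partial (Cf j) (f0 j).
Qed.

(** The only place where [grad u] in L^2 enters: the enstrophy is a combination of squares of L^2
    functions. *)
Lemma integrable_enstrophy (u : 'rV[R]_3 -> 'rV[R]_3) : gradient_in_L2 u ->
  leb3.-integrable setT (fun z => (enstrophy u (point3 z))%:E).
Proof.
move=> gL2.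
have I i j : leb3.-integrable setT (fun z =>
  (vorticity u i j (point3 z) ^+ 2)%:E).
  have le12 : (1 <= 2%:E :> \bar R)%E by rewrite lee_fin ler1n.
  have L2 := rpredB (gL2 i j) (gL2 j i).
  exact: Lfun2_integrable_sqr (L2 le12).
have -> : (fun z => (enstrophy u (point3 z))%:E) =
   (fun z => 2^-1%:E * \sum_i \sum_j (vorticity u i j (point3 z) ^+ 2)%:E)%E.
  apply/funext => z; rewrite /enstrophy EFinM; congr (_ * _)%E.
  by rewrite -sumEFin; apply: eq_bigr => i _; rewrite -sumEFin.
apply: integrableZl => //; apply: integrable_sum => // i _.
exact: integrable_sum.
Qed.

Definition itv_around (a r : R) : set RR := `[a - r, a + r]%classic.

(** The closed ball for the sup norm, written as a product of intervals so that its measure can be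
    computed. *)
Definition box_around (c : 'rV[R]_3) (r : R) : set (RR * RR * RR) :=
  (itv_around (c ord0 (@Ordinal 3 0 isT)) r `*` itv_around (c ord0
    (@Ordinal 3 1 isT)) r) `*`
  itv_around (c ord0 (@Ordinal 3 2 isT)) r.

Lemma measurable_itv_around a r : measurable (itv_around a r).
Proof. exact: measurable_itv. Qed.
Hint Resolve measurable_itv_around : core.

Lemma measurable_box_around c r : measurable (box_around c r).
Proof. by apply: measurableX => //; apply: measurableX. Qed.

Lemma lebesgue_itv_around a r : 0 < r -> leb (itv_around a r) = (2 * r)%:E.
Proof.
move=> r0; rewrite lebesgue_measure_itv /= lte_fin ltrBlDr -addrA ltrDl
  addr_gt0//.
by rewrite -EFinD; congr _%:E; ring.
Qed.

Lemma lebesgue3_box_around c r : 0 < r -> leb3 (box_around c r) =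
  ((2 * r) ^+ 3)%:E.
Proof.
move=> r0; pose c0 := c ord0 (@Ordinal 3 0 isT);
  pose c1 := c ord0 (@Ordinal 3 1 isT).
have -> : leb3 (box_around c r) = ((leb \x leb)
  (itv_around c0 r `*` itv_around c1 r) *
    leb (itv_around (c ord0 (@Ordinal 3 2 isT)) r))%E.
  by apply: product_measure1E => //; exact: measurableX.
rewrite product_measure1E// [X in (X * _ * _)%E](lebesgue_itv_around c0 r0).
rewrite [X in (_ * X * _)%E](lebesgue_itv_around c1 r0) lebesgue_itv_around//
  -!EFinM.
by congr _%:E; ring.
Qed.

Lemma box_around_dist c r z : box_around c r z -> `|c - point3 z| <= r.
Proof.
case=> -[]; rewrite /itv_around /= !in_itv /= =>
  /andP[a1 a2] /andP[b1 b2] /andP[c1 c2].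
rewrite [leLHS]/Num.norm /= mx_normrE; apply/bigmax_leP; split; first by lra.
case=> [i [[|[|[|//]]] lt3]] _ /=; rewrite !mxE /= (ord1 i).
- by rewrite (_ : Ordinal lt3 = @Ordinal 3 0 isT); [rewrite ler_norml;
    apply/andP; split; lra|exact: val_inj].
- by rewrite (_ : Ordinal lt3 = @Ordinal 3 1 isT); [rewrite ler_norml;
    apply/andP; split; lra|exact: val_inj].
- by rewrite (_ : Ordinal lt3 = @Ordinal 3 2 isT); [rewrite ler_norml;
    apply/andP; split; lra|exact: val_inj].
Qed.

End integral.

(** * Consequences of decay at infinity *)

Section at_infinity.
Context (R : realType) (n : nat) (u : 'rV[R]_n.+1 -> 'rV[R]_n.+1) (p :
  'rV[R]_n.+1 -> R).
Context (u_smooth : smooth_field u) (p_smooth : smooth p) (NS :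
  stationary_NS u p)
  (u_infty : u x @[x --> at_infty] --> (0 : 'rV[R]_n.+1))
  (p_infty : p x @[x --> at_infty] --> (0 : R)).
Local Notation Q := (total_head u p).

Lemma bounded_above_at_infty0 (f : 'rV[R]_n.+1 -> R) : continuous f ->
  f x @[x --> at_infty] --> 0 -> exists B, forall x, f x <= B.
Proof.
move=> cf f0; have [[x fx]|/forallNP fN] := pselect (exists x, 0 < f x);
  last first.
  by exists 0 => x; rewrite leNgt; apply/negP/fN.
have [M HM] := at_infty0_norm f0 fx.
have [|y H] := continuous_attains_max (x := x) (M := M) cf.
  by move=> y /HM; apply: le_lt_trans (ler_norm _).
by exists (f y).
Qed.

Lemma component_at_infty j : component u j x @[x --> at_infty] --> 0.
Proof.
have -> : (0 : R) = (0 : 'rV[R]_n.+1) ord0 j by rewrite mxE.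
apply: (@continuous_cvg _ _ _ _ _ u (fun y : 'rV[R]_n.+1 => y ord0 j)) => //.
exact: coord_continuous.
Qed.

Lemma sqr_speedE : (fun x => enorm (u x) ^+ 2) = fun x =>
  \sum_j component u j x ^+ 2.
Proof. by apply/funext => x; rewrite sqr_enorm. Qed.

Lemma continuous_sqr_speed : continuous (fun x => enorm (u x) ^+ 2).
Proof.
rewrite sqr_speedE; apply: continuous_sum => j.
exact: C1_continuous (C1_mul (smooth_C1 (u_smooth j)) (smooth_C1
  (u_smooth j))).1.
Qed.

Lemma sqr_speed_at_infty : enorm (u x) ^+ 2 @[x --> at_infty] --> 0.
Proof.
have H := @cvg_big R _ +%R 0 predT (fun z => @add_continuous R z) _ at_infty
  (index_enum _) (fun j x => component u j x ^+ 2) (fun=> 0 * 0)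
    (@at_infty_filter R n.+1).
rewrite sqr_speedE; move: H; rewrite [X in _ --> X]big1 => [|j _];
  last by rewrite mul0r.
by apply=> j _; exact: (cvgM (component_at_infty j) (component_at_infty j)).
Qed.

Lemma total_head_at_infty : Q x @[x --> at_infty] --> 0.
Proof.
have -> : (0 : R) = 0 / 2 + 0 by rewrite mul0r addr0.
apply: cvgD => //; apply: cvgM; [exact: sqr_speed_at_infty|exact: cvg_cst].
Qed.

Lemma enstrophy_ge0 x : 0 <= enstrophy u x.
Proof.
rewrite mulr_ge0// sumr_ge0// => i _; apply: sumr_ge0 => j _; exact: sqr_ge0.
Qed.

Lemma sqr_component_bounded : exists B, forall x, \sum_j component u j x ^+ 2
  <= B.
Proof.
have [B HB] := bounded_above_at_infty0 continuous_sqr_speed sqr_speed_at_infty.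
by exists B => x; rewrite -[leLHS]sqr_enorm.
Qed.

(** If [Q] is negative somewhere, the strict principle with [M = 0] spreads this to every point.
    Otherwise the weak principle forces [Q = 0], and [total_head_equation] makes the enstrophy
    vanish. *)
Lemma total_head_lt0 : (exists x, enstrophy u x != 0) -> forall x, Q x < 0.
Proof.
move=> [x0 wx0]; have [B HB] := sqr_component_bounded.
have CQ := (C1_total_head u_smooth p_smooth NS).1.
have C2Q j := (C1_partial_total_head u_smooth p_smooth NS j).1.
have LQ x : 0 <= laplacian Q x - \sum_i component u i x * partial i Q x.
  by rewrite (total_head_equation u_smooth p_smooth NS) enstrophy_ge0.
have [[c Qc]|/forallNP QN] := pselect (exists c, Q c < 0).
  exact: (strict_max_principle CQ C2Q HB LQ total_head_at_infty (lexx 0) Qc).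
have Q0 : Q = fun _ => 0.
  apply/funext => x; apply/eqP; rewrite eq_le.
  rewrite (maximum_principle CQ C2Q HB LQ total_head_at_infty)/= leNgt.
  exact/negP/QN.
move: wx0; rewrite -(total_head_equation u_smooth p_smooth NS) Q0.
rewrite /laplacian !big1 ?subr0 ?eqxx// => i _; by rewrite !partial_cst ?mulr0.
Qed.

(** By [laplacian_velocity] the components are harmonic; the maximum principle with zero drift is
    applied to each of them and to its opposite. *)
Lemma enstrophy_eq0_velocity : (forall x, enstrophy u x =
  0) -> forall x, u x = 0.
Proof.
move=> w0.
have W0 i j : vorticity u i j = fun _ => 0.
  apply/funext => x; apply/eqP; rewrite -sqrf_eq0.
  have /eqP := w0 x; rewrite mulf_eq0 invr_eq0 pnatr_eq0 /= psumr_eq0;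
    last first.
    by move=> k _; apply: sumr_ge0 => l _; exact: sqr_ge0.
  move=> /allP /(_ i (mem_index_enum _)) /=; rewrite psumr_eq0; last first.
    by move=> l _; exact: sqr_ge0.
  by move=> /allP /(_ j (mem_index_enum _)).
have lap0 j x : laplacian (component u j) x = 0.
  rewrite (laplacian_velocity u_smooth NS) /div_vorticity.
  by apply: big1 => i _; rewrite W0 partial_cst.
have le0 j x : component u j x <= 0.
  apply: (@maximum_principle _ _ _ (fun _ _ => 0) 0).
  - exact: smooth_C1 (u_smooth j).
  - by move=> i; exact: smooth_C1 (smooth_partial i (u_smooth j)).
  - by move=> y; rewrite big1// => i _; rewrite expr0n.
  - by move=> y; rewrite lap0 big1 ?subr0// => i _; rewrite mul0r.
  - exact: component_at_infty.
have ge0 j x : - component u j x <= 0.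
  have [CN dN] := C1_opp (smooth_C1 (u_smooth j)).
  have CNN i := C1_opp (smooth_C1 (smooth_partial i (u_smooth j))).
  apply: (@maximum_principle _ _ (fun x => - component u j x) (fun _ _ => 0) 0).
  - exact: CN.
  - by move=> i; rewrite dN; exact: (CNN i).1.
  - by move=> y; rewrite big1// => i _; rewrite expr0n.
  - move=> y; rewrite [X in _ - X]big1 ?subr0; last by move=> i _;
      rewrite mul0r.
    have -> : laplacian (fun x => - component u j x) y =
      - laplacian (component u j) y.
      by rewrite /laplacian -sumrN; apply: eq_bigr => i _; rewrite dN (CNN i).2.
    by rewrite lap0 oppr0.
  - rewrite -oppr0; apply: cvgN; exact: component_at_infty.
move=> x; apply/rowP => j; rewrite mxE; apply/eqP; rewrite eq_le.
by rewrite [X in X && _]le0 -oppr_le0 [X in is_true X]ge0.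
Qed.

Lemma continuous_enstrophy : continuous (enstrophy u).
Proof.
have CW i j : C1 (fun x => vorticity u i j x ^+ 2).
  have [C _] := C1_vorticity u_smooth i j; exact: (C1_mul C C).1.
have CS i := (C1_sum (CW i)).1.
exact: C1_continuous (C1_mul (@C1_cst R n.+1 2^-1).1 (C1_sum CS).1).1.
Qed.

Context (Q_cond : limsup_ratio_finite u Q) (Q_lt0 : forall x, Q x < 0).

(** Far out, [- Q < 1] and the hypothesis gives the bound through [dloglog_mul_le1]. If that bound
    fails somewhere, the product, continuous because [Q] never vanishes, attains its maximum. *)
Lemma dloglog_sqr_speed_bounded :
  exists2 C, 0 <= C & forall x, dloglog (- Q x) * enorm (u x) ^+ 2 <= C.
Proof.
have [C [R0 [C0 _ HC]]] := Q_cond.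
have [M HM] := at_infty0_norm total_head_at_infty ltr01.
have far x : Num.max M R0 < `|x| -> dloglog (- Q x) * enorm (u x) ^+ 2 <= C.
  rewrite gt_max => /andP[Mx R0x].
  have Q0 : 0 < - Q x by rewrite oppr_gt0.
  have := HC x (lt_le_trans R0x (norm_le_enorm x)); rewrite ltr0_norm// => h.
  rewrite (le_trans (ler_wpM2l (ltW (dloglog_gt0 Q0)) h))// mulrCA ger_pMr//.
  by apply: dloglog_mul_le1 => //; rewrite -ltr0_norm// HM.
have [[x fx]|/forallNP fN] := pselect (exists x, C < dloglog (- Q x) * enorm
  (u x) ^+ 2).
  have [||y ymax] := @continuous_attains_max _ _
    (fun x => dloglog (- Q x) * enorm (u x) ^+ 2) x (Num.max M R0).
  - have cq : continuous (fun x => - Q x).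
      exact: C1_continuous (C1_opp (C1_total_head u_smooth p_smooth NS).1).1.
    have c : continuous (fun x => dloglog (- Q x)).
      move=> y. apply: (@continuous_comp _ _ _ (fun x => - Q x) (@dloglog R)).
        exact: cq.
      by apply: continuous_dloglog; rewrite oppr_gt0.
    by move=> y; exact: (continuousM (c y) (@continuous_sqr_speed y)).
  - by move=> y /far /le_lt_trans; apply.
  exists (dloglog (- Q y) * enorm (u y) ^+ 2) => //.
  exact: le_trans (ltW C0) (le_trans (ltW fx) (ymax x)).
exists C; first exact: ltW.
by move=> x; rewrite leNgt; apply/negP/fN.
Qed.

Lemma loglog_total_head_bounded : exists B, forall x, loglog (- Q x) <= B.
Proof.
have [CN _] := C1_opp (C1_total_head u_smooth p_smooth NS).1.
have N0 : - Q x @[x --> at_infty] --> 0.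
  by rewrite -oppr0; apply: cvgN; exact: total_head_at_infty.
have [B HB] := bounded_above_at_infty0 (C1_continuous CN) N0.
by exists (loglog B) => x; apply: ler_loglog; rewrite ?oppr_gt0.
Qed.

End at_infinity.

(** * The weighted energy inequality and its limit for large T *)

Section energy.
Context (R : realType) (u : 'rV[R]_3 -> 'rV[R]_3) (p : 'rV[R]_3 -> R).
Context (u_smooth : smooth_field u) (p_smooth : smooth p) (NS :
  stationary_NS u p)
  (grad_L2 : gradient_in_L2 u)
  (p_infty : p x @[x --> at_infty] --> (0 : R))
  (u_infty : u x @[x --> at_infty] --> (0 : 'rV[R]_3)).
Local Notation Q := (total_head u p).
Local Notation leb3 := (lebesgue3 R).
Context (Q_lt0 : forall x, Q x < 0) (C B : R)
  (C_ge0 : 0 <= C)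
  (speed_le : forall x, dloglog (- Q x) * enorm (u x) ^+ 2 <= C)
  (loglog_le : forall x, loglog (- Q x) <= B).

(** The flux has integral 0, and [div_flux_le] bounds its divergence pointwise. The good term is
    replaced by [d] times the indicator of a box, the bad one by a multiple of the integrable
    enstrophy. *)
Lemma energy_inequality (T d r : R) (c : 'rV[R]_3) : 0 < r -> 0 <= T + B ->
  (forall x, `|c - x| <= r -> d <= cut T (- Q x) * enstrophy u x) ->
  d * (2 * r) ^+ 3 <=
  4 * C * (T + B) * fine (\int[leb3]_z (enstrophy u (point3 z))%:E)%E.
Proof.
move=> r0 TB dle.
have [a [H [a0 Hsmall dH]]] := cut_antiderivative T.
have [M HM] := at_infty0_norm (total_head_at_infty u_infty p_infty) a0.
(* Beyond [M] one has [- Q < a], where both the cut-off and its primitive are 0: the flux has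
   compact support. *)
have N0 j x : M < `|x| -> flux u p T H j x = 0.
  move=> /HM; rewrite ltr0_norm// => Qa.
  have Q0 : 0 < - Q x by rewrite oppr_gt0.
  have [c0 _ H0] := Hsmall (- Q x) Q0 (ltW Qa).
  by rewrite /flux c0 H0 !mul0r subrr.
have [intN intN0] := integral_div (fun j =>
  (C1_flux u_smooth p_smooth NS Q_lt0 dH j).1) N0.
have intw := integrable_enstrophy grad_L2.
(* One factor 2 comes from differentiating the square in [cut], the other from [sqr_lamb_le];
   [T + B] bounds [pos_part (T + loglog (- Q))], and [C] bounds [dloglog (- Q) |u|^2]. *)
pose K := 4 * C * (T + B).
have pt z : d * \1_(box_around c r) z - K * enstrophy u (point3 z) <=
    - \sum_j partial j (flux u p T H j) (point3 z).
  set x := point3 z.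
  have w0 := enstrophy_ge0 u x.
  have Q0 : 0 < - Q x by rewrite oppr_gt0.
  have h1 : d * \1_(box_around c r) z <= cut T (- Q x) * enstrophy u x.
    rewrite indicE; have [|_] := boolP (z \in box_around c r); last first.
      by rewrite mulr0 mulr_ge0// sqr_ge0.
    by rewrite inE mulr1 => /box_around_dist; exact: dle.
  have h2 : dcut T (- Q x) * (2 * enorm (u x) ^+ 2 * enstrophy u x) <=
    K * enstrophy u x.
    rewrite mulrA ler_wpM2r// /dcut /K.
    rewrite (_ : _ * _ = 4 * pos_part (T + loglog (- Q x)) *
      (dloglog (- Q x) * enorm (u x) ^+ 2)); last by ring.
    rewrite (_ : 4 * C * (T + B) = 4 * (T + B) * C); last by ring.
    rewrite ler_pM//.
    - by rewrite mulr_ge0// le_max lexx.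
    - by rewrite mulr_ge0 ?sqr_ge0// ltW// dloglog_gt0.
    - by rewrite ler_pM2l// ge_max TB lerD2l loglog_le.
  have h3 := div_flux_le u_smooth p_smooth NS Q_lt0 dH x.
  rewrite lerNr (le_trans h3)// opprB lerB//.
have int0 : leb3.-integrable setT (EFin \o (\1_(box_around c r) : _ -> R)).
  apply: (@integrable_bounded_support _ _ _ leb3 _ (box_around c r) 1).
  - exact: measurable_box_around.
  - by rewrite lebesgue3_box_around// ltry.
  - by apply: measurable_indic; exact: measurable_box_around.
  - by move=> z; rewrite indicE; case: (z \in box_around c r);
      rewrite ?normr1 ?normr0.
  - by move=> z zB; rewrite indicE memNset.
have int1 : leb3.-integrable setT (EFin \o (fun z =>
  d * \1_(box_around c r) z)).
  exact: (integrableZl measurableT d int0).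
have int2 : leb3.-integrable setT (EFin \o (fun z =>
  K * enstrophy u (point3 z))).
  exact: (integrableZl measurableT K intw).
have int3 : leb3.-integrable setT
    (EFin \o (fun z => - \sum_j partial j (flux u p T H j) (point3 z))).
  exact: (integrableN intN).
have int12 : leb3.-integrable setT
    (EFin \o (fun z => d * \1_(box_around c r) z - K * enstrophy u (point3 z))).
  exact: (integrableB measurableT int1 int2).
have := le_Rintegral measurableT int12 int3 (fun z _ => pt z).
rewrite [X in X <= _](RintegralB measurableT int1 int2).
rewrite [X in X - _ <= _](RintegralZl d measurableT int0).
rewrite [X in _ - X <= _](RintegralZl K measurableT intw).
have -> : (\int[leb3]_z \1_(box_around c r) z = (2 * r) ^+ 3)%R.
  by rewrite /Rintegral integral_indic ?setIT ?lebesgue3_box_around//;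
    exact: measurable_box_around.
have -> : (\int[leb3]_z - \sum_j partial j (flux u p T H j) (point3 z) = 0)%R.
  rewrite /Rintegral; transitivity
    (fine (- \int[leb3]_z (\sum_j partial j (flux u p T H j) (point3 z))%:E)%E).
    by rewrite -integralN//; exact: integrable_add_def.
  by rewrite intN0 oppe0.
by rewrite subr_le0.
Qed.

(** Around a point of positive enstrophy, both the enstrophy and [- Q] stay above half their central
    values on a box independent of [T]. The energy inequality then bounds a quadratic function of
    [T] by a linear one. *)
Lemma enstrophy_eq0 x : enstrophy u x = 0.
Proof.
apply/eqP; rewrite eq_le enstrophy_ge0 andbT leNgt; apply/negP => w0.
pose d := enstrophy u x / 2; have d0 : 0 < d by rewrite divr_gt0.
pose s := - Q x / 2; have s0 : 0 < s by rewrite divr_gt0// oppr_gt0.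
have cq : continuous (fun y => - Q y).
  exact: C1_continuous (C1_opp (C1_total_head u_smooth p_smooth NS).1).1.
have /cvgrPdist_lt /(_ _ d0) /nbhs_ballP[r1 /= r10 H1] :=
  @continuous_enstrophy _ _ _ u_smooth x.
have /cvgrPdist_lt /(_ _ s0) /nbhs_ballP[r2 /= r20 H2] := cq x.
(* Strictly smaller than both radii, because the box is closed while the continuity balls are
   open. *)
have [r [r0 rr1 rr2]] : exists r, [/\ 0 < r, r < r1 & r < r2].
  exists (Num.min r1 r2 / 2).
  have m0 : 0 < Num.min r1 r2 by rewrite lt_min r10.
  have m2 : Num.min r1 r2 / 2 < Num.min r1 r2 by lra.
  by split; [rewrite divr_gt0|rewrite (lt_le_trans m2)// ge_min lexx|
    rewrite (lt_le_trans m2)// ge_min lexx orbT].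
have near_x y : `|x - y| <= r -> d <= enstrophy u y /\ s <= - Q y.
  move=> xy; split.
    have /H1 /= : ball x r1 y by rewrite -ball_normE; exact: le_lt_trans rr1.
    by rewrite ltr_norml => /andP[_]; rewrite /d; lra.
  have /H2 /= : ball x r2 y by rewrite -ball_normE; exact: le_lt_trans rr2.
  by rewrite ltr_norml => /andP[_]; rewrite /s; lra.
set I := fine (\int[leb3]_z (enstrophy u (point3 z))%:E)%E.
have I0 : 0 <= I.
  by apply: fine_ge0; apply: integral_ge0 => z _; rewrite lee_fin enstrophy_ge0.
(* Past this threshold both [T + B] and [T + loglog s] are nonnegative, as the energy inequality and
   the comparison of squares require. *)
apply: (@quadratic_gt_linear R (d * (2 * r) ^+ 3) (4 * C * I) (loglog s) B
  (Num.max (- B) (- loglog s))).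
- by rewrite mulr_gt0// exprn_gt0// mulr_gt0.
- by rewrite !mulr_ge0.
move=> T; rewrite ge_max => /andP[TB Ts].
rewrite mulrA [leRHS]mulrAC.
have TB0 : 0 <= T + B by lra.
apply: (@energy_inequality T _ r x r0 TB0) => y /near_x[wy sy].
rewrite ler_pM ?sqr_ge0 ?(ltW d0)//.
have Ts0 : 0 <= T + loglog s by lra.
have TQ : T + loglog s <= T + loglog (- Q y) by rewrite lerD2l ler_loglog.
rewrite /cut lerXn2r ?nnegrE//; first by rewrite le_max lexx.
by rewrite le_max TQ orbT.
Qed.

End energy.

Unset Implicit Arguments.

Theorem theorem1p2 (R : realType)
    (u : 'rV[R]_3 -> 'rV[R]_3) (p : 'rV[R]_3 -> R)
    (u_smooth : smooth_field u) (p_smooth : smooth p)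
    (NS : stationary_NS u p)
    (grad_L2 : gradient_in_L2 u)
    (u_infty : u x @[x --> at_infty] --> (0 : 'rV[R]_3))
    (p_infty : p x @[x --> at_infty] --> (0 : R))
    (Q_cond : limsup_ratio_finite u (total_head u p)) :
  forall x : 'rV[R]_3, u x = 0.
Proof.
apply: (enstrophy_eq0_velocity u_smooth NS u_infty) => x.
(* The goal is itself that the enstrophy vanishes at [x]; the assumption that it does not serves to
   make [Q] negative, so that the cut-off of [- Q] is differentiable. *)
have [//|wx] := eqVneq (enstrophy u x) 0.
have Q_lt0 := total_head_lt0 u_smooth p_smooth NS u_infty p_infty
  (ex_intro _ x wx).
have [C C_ge0 HC] := dloglog_sqr_speed_bounded u_smooth p_smooth NS u_infty
  p_infty
  Q_cond Q_lt0.
have [B HB] := loglog_total_head_bounded u_smooth p_smooth NS u_infty p_infty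
  Q_lt0.
exact: (enstrophy_eq0 u_smooth p_smooth NS grad_L2 p_infty u_infty Q_lt0
  C_ge0 HC HB).
Qed.
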